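(* Consider a sequence (indexed by the number of states $n$) of Block Markov Chains with fixed parameters $(\alpha,p)$, as defined in the context. Assume $\min_{k\in[K]}\alpha_k>0$ and that $p$ is irreducible (with stationary distribution $\pi$). Let $\hat N$ be the transition count matrix and $N_{x,y}=\mathbb E[\hat N_{x,y}]=\ell_n\Pi_xP_{x,y}$. Then: (a) If $\ell_n=\Omega(n\ln n)$, then $\sigma_1(\hat N-N)=O_{\mathbb P}(\sqrt{\ell_n/n})$. (b) If $\ell_n=\omega(n)$ and $\Gamma\subseteq[n]$ is such that its complement $\Gamma^{\mathrm c}$ is a set of size $\lfloor ne^{-\ell_n/n}\rfloor$ containing the states with the highest number of visits, then $\sigma_1(\hat N_\Gamma-N)=O_{\mathbb P}(\sqrt{\ell_n/n})$, where $(\hat N_\Gamma)_{x,y}=\hat N_{x,y}\mathbf 1\{x\in\Gamma,\,y\in\Gamma\}$.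
   Context: Notation: $[m]=\{1,\dots,m\}$; for deterministic positive sequences, $a_n=\omega(b_n)$ means $a_n/b_n\to\infty$, and $a_n=\Omega(b_n)$ means $\liminf a_n/b_n>0$. For random variables $Y_n$: $Y_n=O_{\mathbb P}(a_n)$ iff for every $\varepsilon>0$ there are $\delta_\varepsilon,N_\varepsilon$ with $\mathbb P[|Y_n/a_n|\ge\delta_\varepsilon]\le\varepsilon$ for all $n>N_\varepsilon$. $\sigma_1(A)$ is the largest singular value (spectral norm) of $A$. Block Markov Chain (BMC): fix $K\in\mathbb N_{\ge1}$, a stochastic matrix $p=(p_{i,j})_{i,j\in[K]}$ and $\alpha=(\alpha_k)_{k\in[K]}$ with $\sum_k\alpha_k=1$. For each (sufficiently large) $n$ there is a surjective map $\sigma:[n]\to[K]$ (depending on $n$) with clusters $\mathcal V_k=\sigma^{-1}(k)$ satisfying $|\mathcal V_k|/n\to\alpha_k$ as $n\to\infty$. The BMC is the Markov chain $(X_t)_{t\ge0}$ on $[n]$ with transition matrix $P_{x,y}=p_{\sigma(x),\sigma(y)}/|\mathcal V_{\sigma(y)}|$. If $p$ is irreducible with stationary distribution $\pi$, then $\Pi_x=\pi_{\sigma(x)}/|\mathcal V_{\sigma(x)}|$ is the unique stationary distribution of $P$. One observes a trajectory $X_0,\dots,X_{\ell_n}$ with $X_0\sim\Pi$, where $(\ell_n)$ is a deterministic sequence of positive integers. The count matrix is $\hat N_{x,y}=\sum_{t=0}^{\ell_n-1}\mathbf 1\{X_t=x,X_{t+1}=y\}$, and the number of visits to $y$ is $\sum_{x\in[n]}\hat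 N_{x,y}$ (ties between states broken arbitrarily). *)

(* Defs.v *)
From HB Require Import structures.
From mathcomp Require Import all_boot all_order all_algebra.
From mathcomp Require Import all_classical all_reals all_analysis.

Set Implicit Arguments.
Unset Strict Implicit.
Unset Printing Implicit Defensive.

Import Order.TTheory GRing.Theory Num.Theory.
Import numFieldNormedType.Exports.

Local Open Scope classical_set_scope.
Local Open Scope ring_scope.

(* A sequence indexed by the number of states is here a function of n : nat
   whose n-th term concerns the chain on the n.+1 states 'I_n.+1: no random
   variable can take values in 'I_0. *)

Section Asymptotics.
Variable R : realType.

Definition is_omega (a b : nat -> R) : Prop := a n / b n @[n --> \oo] --> +oo.

Definition is_Omega (a b : nat -> R) : Prop :=
  (0 < limn_einf (fun n => (a n / b n)%:E))%E.

Definition bigO_prob (d : nat -> measure_display)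
    (T : forall n, measurableType (d n)) (Pr : forall n, probability (T n) R)
    (Y : forall n, T n -> R) (a : nat -> R) : Prop :=
  forall eps : R, 0 < eps -> exists (delta : R) (N : nat),
    forall n, (N < n)%N ->
      (Pr n [set w | (delta <= `|Y n w / a n|)%R] <= eps%:E)%E.

End Asymptotics.

Section LinearAlgebra.
Variable R : realType.

(* The singular values of A are the square roots of the eigenvalues of A^T A;
   for n > 0 there are finitely many and at least one, so that the supremum is
   a maximum. *)
Definition sigma1 (n : nat) (A : 'M[R]_n) : R :=
  sup [set Num.sqrt a | a in [set a : R | eigenvalue (A^T *m A) a]].

Definition stochastic (K : nat) (p : 'M[R]_K) : Prop :=
  (forall i j, 0 <= p i j) /\ (forall i, \sum_j p i j = 1).

Definition irreducible (K : nat) (p : 'M[R]_K) : Prop :=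
  forall i j, exists m : nat, 0 < (p ^+ m) i j.

Definition stationary (K : nat) (p : 'M[R]_K) (pi : 'rV[R]_K) : Prop :=
  [/\ forall k, 0 <= pi 0 k, \sum_k pi 0 k = 1 & pi *m p = pi].

End LinearAlgebra.

Section MarkovChain.
Variables (R : realType) (d : measure_display) (T : measurableType d).
Variables (Pr : probability T R) (n : nat).

(* The Markov property is multiplied out, so that it also makes sense for
   histories x_0, ..., x_t of probability zero. *)
Definition markov_chain (mu : 'rV[R]_n) (Q : 'M[R]_n) (X : nat -> T -> 'I_n) :
    Prop :=
  [/\ forall t x, measurable [set w | X t w = x],
      forall x, Pr [set w | X 0%N w = x] = (mu 0 x)%:E
    & forall (t : nat) (x : nat -> 'I_n),
        Pr [set w | forall i, (i <= t.+1)%N -> X i w = x i] =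
        (Pr [set w | forall i, (i <= t)%N -> X i w = x i] *
         (Q (x t) (x t.+1))%:E)%E].

End MarkovChain.

Section BlockMarkovChain.
Variables (R : realType) (K n : nat) (sigma : 'I_n -> 'I_K).

Definition bmc_cluster (k : 'I_K) : {set 'I_n} := [set x | sigma x == k]%SET.

Definition bmc_transition (p : 'M[R]_K) : 'M[R]_n :=
  \matrix_(x, y) (p (sigma x) (sigma y) / #|bmc_cluster (sigma y)|%:R).

Definition bmc_stationary (pi : 'rV[R]_K) : 'rV[R]_n :=
  \row_x (pi 0 (sigma x) / #|bmc_cluster (sigma x)|%:R).

End BlockMarkovChain.

Section Counts.
Variables (R : realType) (n : nat).

Definition count_mx (l : nat) (x : nat -> 'I_n) : 'M[R]_n :=
  \matrix_(i, j) \sum_(t < l) ((x t == i) && (x t.+1 == j))%:R.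

Definition visits (N : 'M[R]_n) (y : 'I_n) : R := \sum_x N x y.

Definition restrict_mx (G : {set 'I_n}) (N : 'M[R]_n) : 'M[R]_n :=
  \matrix_(x, y) (N x y * ((x \in G) && (y \in G))%:R).

(* Where several states have the same number of visits, any choice of G
   satisfies this. *)
Definition trims_most_visited (l : nat) (N : 'M[R]_n) (G : {set 'I_n}) : Prop :=
  (#|~: G|%SET%:Z = Num.floor (n%:R * expR (- (l%:R / n%:R)) : R)) /\
  (forall x y, x \notin G -> y \in G -> visits N y <= visits N x).

Definition expectation_mx (d : measure_display) (T : measurableType d)
    (Pr : probability T R) (M : T -> 'M[R]_n) : 'M[R]_n :=
  \matrix_(x, y) fine ('E_Pr[fun w => M w x y])%E.

End Counts.

(* Main.v *)
Require Import Defs.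
From HB Require Import structures.
From mathcomp Require Import all_boot all_order all_algebra.
From mathcomp Require Import all_classical all_reals all_analysis.
From mathcomp Require Import measurable_realfun.
From mathcomp Require Import ring lra zify.

Set Implicit Arguments.
Unset Strict Implicit.
Unset Printing Implicit Defensive.

Import Order.TTheory GRing.Theory Num.Theory.
Import numFieldNormedType.Exports.

Local Open Scope classical_set_scope.
Local Open Scope ring_scope.

(* Conditionally on the clusters visited, the states of the chain are independent
   and uniform in their clusters, so the pairs (X_t, X_(t+1)) with t even are
   independent, and so are those with t odd: sums over the path satisfy Chernoff
   bounds with the same constants as in the independent case. With Nt the mean of
   the count matrix given the cluster sequence, the block matrix Nt - N is
   controlled by the variance of the cluster transition counts, which is O(l) by the
   Poisson equation of p (no aperiodicity is needed).

   For the remaining part the argument is that of Feige and Ofek. Vectors are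
   scaled to square norm at most 4 n and rounded to coordinates 0 and +-2^i, and
   2^m plays the role of sqrt (l / n). Pairs of coordinates with product at most 2^m
   (light pairs) are handled by a Chernoff bound and a union bound over the net. For
   the heavy pairs only the counts matter: if one coordinate exceeds the other by a
   factor 2^m, bounded degrees suffice; otherwise the number of transitions between
   the level sets i and j is bounded, uniformly over all sets of states, with
   Chernoff parameter proportional to k = i + j - m. A set of s states at level i is
   charged about 4 (i + 1) s + n 16^-(i+1) in the union bound, and these charges sum
   to O(n 2^m) over all levels.

   Degrees are bounded on Gamma: in case (a) no state has more than a multiple of
   l / n visits, and in case (b) the expected number of such states is at most
   n exp (-2 l / n), so with high probability all of them are trimmed. *)

(** * Expectations along a path of a Markov chain *)

Section PathExpectation.
Variables (R : realType) (I : finType) (P : I -> I -> R).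
Hypothesis P0 : forall x y, 0 <= P x y.
Hypothesis P1 : forall x, \sum_y P x y = 1.

(* The argument of f is the trajectory after its starting point x. *)
Fixpoint pathE (t : nat) (x : I) (f : seq I -> R) : R :=
  if t is t'.+1 then \sum_y P x y * pathE t' y (fun s => f (y :: s))
  else f [::].

Lemma le_pathE t x f g : (forall s, size s = t -> f s <= g s) ->
  pathE t x f <= pathE t x g.
Proof.
elim: t x f g => [|t IH] x f g fg /=; first exact: fg.
apply: ler_sum => y _; apply: ler_wpM2l; first exact: P0.
by apply: IH => s st; apply: fg; rewrite /= st.
Qed.

Lemma pathE_cst t x c : pathE t x (fun _ => c) = c.
Proof.
elim: t x => [//|t IH] x /=.
under eq_bigr do rewrite IH.
by rewrite -mulr_suml P1 mul1r.
Qed.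

Lemma pathE_sum (J : Type) (r : seq J) (Q : pred J) t x (F : J -> seq I -> R) :
  pathE t x (fun s => \sum_(j <- r | Q j) F j s) =
  \sum_(j <- r | Q j) pathE t x (F j).
Proof.
elim: t x F => [//|t IH] x F /=.
under eq_bigr do rewrite IH mulr_sumr.
by rewrite exchange_big.
Qed.

Lemma pathEZ t x c f : pathE t x (fun s => c * f s) = c * pathE t x f.
Proof.
elim: t x f => [//|t IH] x f /=.
by rewrite mulr_sumr; apply: eq_bigr => y _; rewrite IH mulrCA.
Qed.

Lemma pathED t x f g : pathE t x (fun s => f s + g s) = pathE t x f + pathE t x g.
Proof.
elim: t x f g => [//|t IH] x f g /=.
by rewrite -big_split; apply: eq_bigr => y _; rewrite IH mulrDr.
Qed.

Fixpoint psum (f : I -> I -> R) (x : I) (s : seq I) : R :=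
  if s is y :: s' then f x y + psum f y s' else 0.

Lemma psumZ c f x s : psum (fun a b => c * f a b) x s = c * psum f x s.
Proof. by elim: s x => [|y s IH] x /=; rewrite ?mulr0// IH mulrDr. Qed.

Lemma eq_psum f g x s : (forall a b, f a b = g a b) -> psum f x s = psum g x s.
Proof. by move=> fg; elim: s x => [|y s IH] x //=; rewrite fg IH. Qed.

Lemma psum_cst c x s : psum (fun _ _ => c) x s = c *+ size s.
Proof. by elim: s x => [|y s IH] x //=; rewrite IH mulrS. Qed.

Lemma psum_sum (J : Type) (r : seq J) (Q : pred J) (F : J -> I -> I -> R) x s :
  psum (fun a b => \sum_(j <- r | Q j) F j a b) x s =
  \sum_(j <- r | Q j) psum (F j) x s.
Proof.
elim: s x => [|y s IH] x /=; first by rewrite big1.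
by rewrite IH -big_split.
Qed.

Lemma psum_ge0 f x s : (forall a b, 0 <= f a b) -> 0 <= psum f x s.
Proof. by move=> f0; elim: s x => [|y s IH] x //=; rewrite addr_ge0. Qed.

Lemma psum_telescope (g : I -> R) x s :
  psum (fun a b => g b - g a) x s = g (last x s) - g x.
Proof. by elim: s x => [|y s IH] x /=; rewrite ?subrr// IH addrC addrA subrK. Qed.

(* Orthogonality of martingale increments. *)
Lemma pathE_sqr_martingale (phi : I -> I -> R) (M : R) t x c :
  (forall a, \sum_b P a b * phi a b = 0) ->
  (forall a b, phi a b ^+ 2 <= M) ->
  pathE t x (fun s => (c + psum phi x s) ^+ 2) <= c ^+ 2 + t%:R * M.
Proof.
(* The constant [c] carries the increments already made, so the induction applies with [c + phi x b]
   after the first step. *)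
move=> phi0 phiM; elim: t x c => [|t IH] x c /=; first by rewrite mul0r !addr0.
apply: (@le_trans _ _ (\sum_b P x b * ((c + phi x b) ^+ 2 + t%:R * M))).
  apply: ler_sum => b _; apply: ler_wpM2l; first exact: P0.
  by rewrite (_ : (fun s => _) = (fun s => (c + phi x b + psum phi b s) ^+ 2));
    [exact: IH | apply/funext => s /=; rewrite addrA].
have -> : \sum_b P x b * ((c + phi x b) ^+ 2 + t%:R * M) =
  c ^+ 2 * \sum_b P x b + (2 * c) * \sum_b P x b * phi x b +
  \sum_b P x b * phi x b ^+ 2 + (t%:R * M) * \sum_b P x b.
  rewrite !mulr_sumr -!big_split /=; apply: eq_bigr => b _; ring.
rewrite phi0 P1 !mulr1 mulr0 addr0 -addrA lerD2l -natr1 mulrDl mul1r addrC lerD2l.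
apply: (@le_trans _ _ (\sum_b P x b * M)).
  by apply: ler_sum => b _; apply: ler_wpM2l; [exact: P0 | exact: phiM].
by rewrite -mulr_suml P1 mul1r.
Qed.

Variable mu : I -> R.
Hypothesis mu0 : forall x, 0 <= mu x.
Hypothesis mu1 : \sum_x mu x = 1.

Definition chainE (t : nat) (f : I -> seq I -> R) : R :=
  \sum_x mu x * pathE t x (f x).

Lemma le_chainE t f g : (forall x s, size s = t -> f x s <= g x s) ->
  chainE t f <= chainE t g.
Proof.
move=> fg; apply: ler_sum => x _; apply: ler_wpM2l => //.
by apply: le_pathE => s st; apply: fg.
Qed.

Lemma chainE_cst t c : chainE t (fun _ _ => c) = c.
Proof.
rewrite /chainE; under eq_bigr do rewrite pathE_cst.
by rewrite -mulr_suml mu1 mul1r.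
Qed.

Lemma chainE_sum (J : Type) (r : seq J) (Q : pred J) t (F : J -> I -> seq I -> R) :
  chainE t (fun x s => \sum_(j <- r | Q j) F j x s) =
  \sum_(j <- r | Q j) chainE t (F j).
Proof.
rewrite /chainE exchange_big; apply: eq_bigr => x _.
by rewrite pathE_sum mulr_sumr.
Qed.

Lemma chainEZ t c f : chainE t (fun x s => c * f x s) = c * chainE t f.
Proof.
by rewrite /chainE mulr_sumr; apply: eq_bigr => x _; rewrite pathEZ mulrCA.
Qed.

Lemma chainED t f g :
  chainE t (fun x s => f x s + g x s) = chainE t f + chainE t g.
Proof.
by rewrite /chainE -big_split; apply: eq_bigr => x _; rewrite pathED mulrDr.
Qed.

End PathExpectation.

(** * Exponential moments of path sums *)

Section ExponentialMoment.
Variables (R : realType) (K n : nat) (sigma : 'I_n -> 'I_K).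
Variables (p : 'M[R]_K) (pi : 'rV[R]_K).
Hypothesis hp : stochastic p.
Hypothesis pi0 : forall k, 0 <= pi 0 k.
Hypothesis pi1 : \sum_k pi 0 k = 1.
Hypothesis hsurj : forall k, (0 < #|bmc_cluster sigma k|)%N.

Local Notation v k := (#|bmc_cluster sigma k|%:R : R).
Local Notation P := (fun x y => bmc_transition sigma p x y).
Local Notation mu := (fun x => bmc_stationary sigma pi 0 x).

Lemma cluster_gt0 k : 0 < v k.
Proof. by rewrite ltr0n. Qed.

Lemma sum_cluster1 k : \sum_(x | sigma x == k) (1 : R) = v k.
Proof.
rewrite sumr_const; congr (_%:R); apply: eq_card => x.
by rewrite inE.
Qed.

Lemma sum_cluster_weight (q : 'I_K -> R) (F : 'I_n -> R) :
  \sum_y q (sigma y) / v (sigma y) * F y =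
  \sum_b q b * ((\sum_(y | sigma y == b) F y) / v b).
Proof.
rewrite (partition_big sigma xpredT) //=; apply: eq_bigr => b _.
rewrite mulrA [RHS]mulrAC mulr_sumr; apply: eq_bigr => y /eqP -> //.
Qed.

Lemma le_sum_cluster_weight (q : 'I_K -> R) (F : 'I_n -> R) :
  (forall b, 0 <= q b) -> (forall b, \sum_(y | sigma y == b) F y <= v b) ->
  \sum_y q (sigma y) / v (sigma y) * F y <= \sum_b q b.
Proof.
move=> q0 Fv; rewrite sum_cluster_weight; apply: ler_sum => b _.
by rewrite -[leRHS]mulr1 ler_wpM2l// ler_pdivrMr ?mul1r// cluster_gt0.
Qed.

Lemma bmc_transition_ge0 x y : 0 <= bmc_transition sigma p x y.
Proof. by rewrite mxE divr_ge0 ?hp.1 ?ler0n. Qed.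

Lemma bmc_transition_sum1 x : \sum_y bmc_transition sigma p x y = 1.
Proof.
under eq_bigr => y _ do rewrite mxE -[_ / _]mulr1.
rewrite (sum_cluster_weight (p (sigma x)) (fun _ => 1)) -[RHS](hp.2 (sigma x)).
apply: eq_bigr => b _.
by rewrite /= sum_cluster1 divff ?mulr1// gt_eqF ?cluster_gt0.
Qed.

Lemma bmc_stationary_ge0 x : 0 <= bmc_stationary sigma pi 0 x.
Proof. by rewrite mxE divr_ge0 ?ler0n. Qed.

Lemma bmc_stationary_sum1 : \sum_x bmc_stationary sigma pi 0 x = 1.
Proof.
under eq_bigr => y _ do rewrite mxE -[_ / _]mulr1.
rewrite (sum_cluster_weight (pi 0) (fun _ => 1)) -[RHS]pi1.
apply: eq_bigr => b _.
by rewrite /= sum_cluster1 divff ?mulr1// gt_eqF ?cluster_gt0.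
Qed.

(** The Boolean tells whether the current pair is selected. It flips at each step, so the selected
    pairs share no state: from [true] they start at even times, from [false] at odd times. *)
Fixpoint altprod (h : 'I_n -> 'I_n -> R) (b : bool) (x : 'I_n) (s : seq 'I_n) : R :=
  if s is y :: s' then (if b then h x y else 1) * altprod h (~~ b) y s' else 1.

(* Given the clusters visited, the states of the chain are independent and
   uniform in their clusters, hence so are the disjoint pairs of consecutive
   states selected by altprod. *)
Lemma pathE_altprod (h : 'I_n -> 'I_n -> R) t :
  (forall x y, 0 <= h x y) ->
  (forall a b, \sum_(x | sigma x == a) \sum_(y | sigma y == b) h x y <= v a * v b) ->
  (forall x, pathE P t x (altprod h false x) <= 1) /\
  (forall a, \sum_(x | sigma x == a) pathE P t x (altprod h true x) <= v a).
Proof.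
(* Both parities go through together. If the first pair is selected, the bound holds only after
   averaging over the cluster of the start; if not, it holds for each start. *)
move=> h0 hav; elim: t => [|t [IHf IHt]]; first by split=> // a; rewrite /= sum_cluster1.
split=> [x|a] /=.
  rewrite -[leRHS](hp.2 (sigma x)).
  rewrite (eq_bigr (fun y => p (sigma x) (sigma y) / v (sigma y) *
    pathE P t y (altprod h true y))); last first.
    by move=> y _; rewrite mxE pathEZ mul1r.
  exact: (le_sum_cluster_weight (hp.1 (sigma x)) IHt).
apply: (@le_trans _ _ (\sum_(x | sigma x == a)
    \sum_b p a b * ((\sum_(y | sigma y == b) h x y) / v b))).
  apply: ler_sum => x /eqP xa; rewrite -sum_cluster_weight; apply: ler_sum => y _.
  rewrite mxE xa pathEZ mulrA -[leRHS]mulr1; apply: ler_wpM2l => //.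
  by rewrite mulr_ge0// divr_ge0 ?hp.1 ?ler0n.
have -> : v a = \sum_b p a b * v a by rewrite -mulr_suml hp.2 mul1r.
rewrite exchange_big /=; apply: ler_sum => b _.
rewrite -mulr_sumr -mulr_suml; apply: ler_wpM2l; first exact: hp.1.
by rewrite ler_pdivrMr ?cluster_gt0.
Qed.

(** The two alternating products together use every pair exactly once; the doubled exponent makes
    the exponential of the path sum their geometric mean. *)
Lemma altprod_expR (g : 'I_n -> 'I_n -> R) x s :
  altprod (fun a b => expR (2 * g a b)) true x s *
  altprod (fun a b => expR (2 * g a b)) false x s = expR (psum g x s) ^+ 2.
Proof.
elim: s x => [|y s IH] x /=; first by rewrite expR0 expr1n mulr1.
rewrite mul1r -mulrA (mulrC (altprod _ false _ _)) IH expRD exprMn.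
by congr (_ * _); rewrite -expRM_natl.
Qed.

(** A geometric mean is at most the arithmetic mean, and each alternating product has expectation at
    most 1. The price of the dependence between overlapping pairs is the factor 2 in the exponent of
    the hypothesis, which concerns only averages over pairs of clusters. *)
Lemma chainE_expR_psum (g : 'I_n -> 'I_n -> R) t :
  (forall a b, \sum_(x | sigma x == a) \sum_(y | sigma y == b) expR (2 * g x y)
     <= v a * v b) ->
  chainE P mu t (fun x s => expR (psum g x s)) <= 1.
Proof.
move=> hg; pose h x y := expR (2 * g x y).
have h0 x y : 0 <= h x y by exact: expR_ge0.
have alt0 b x s : 0 <= altprod h b x s.
  by elim: s b x => [|y s IH] b x //=; rewrite mulr_ge0//; case: b.
have [Hf Ht] := pathE_altprod t h0 hg.
apply: (@le_trans _ _ (chainE P mu t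
    (fun x s => 2^-1 * (altprod h true x s + altprod h false x s)))).
  apply: le_chainE => [x y|x|x s _]; [exact: bmc_transition_ge0|exact: bmc_stationary_ge0|].
  have := altprod_expR g x s; rewrite -/h; set a := altprod _ _ _ _.
  set b := altprod _ _ _ _; set e := expR _ => ab.
  have e0 : 0 <= e by exact: expR_ge0.
  have a0 : 0 <= a by exact: alt0.
  have b0 : 0 <= b by exact: alt0.
  rewrite -ler_sqr ?nnegrE ?mulr_ge0 ?addr_ge0 ?invr_ge0// -ab.
  by have := sqr_ge0 (a - b); nra.
rewrite chainEZ chainED.
have Et : chainE P mu t (altprod h true) <= 1.
  rewrite /chainE -[leRHS]pi1; under eq_bigr => y _ do rewrite mxE.
  exact: (le_sum_cluster_weight pi0 Ht).
have Ef : chainE P mu t (altprod h false) <= 1.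
  rewrite -[leRHS]bmc_stationary_sum1; apply: ler_sum => x _.
  by rewrite -[leRHS]mulr1 ler_wpM2l ?Hf// bmc_stationary_ge0.
rewrite -/h in Et Ef *; lra.
Qed.

End ExponentialMoment.

(** * Measurability and the law of trajectories *)

Section DiscreteMeasurability.
Context (d : measure_display) (T : measurableType d).

(** Preimages of all sets are required, so that no sigma-algebra on the target has to be chosen and
    any function may be composed on the left; for a finite target, measurable fibers suffice. *)
Definition discrete_measurable (F : Type) (f : T -> F) :=
  forall A : set F, measurable (f @^-1` A).

Lemma discrete_measurable_fibers (F : finType) (f : T -> F) :
  (forall y, measurable [set w | f w = y]) -> discrete_measurable f.
Proof.
move=> mf A; rewrite (_ : f @^-1` A = \bigcup_(y in A) [set w | f w = y]).
  by apply: fin_bigcup_measurable => //; exact: finite_finset.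
apply/seteqP; split=> w /=; first by move=> Aw; exists (f w).
by move=> [y Ay /= ->].
Qed.

Lemma discrete_measurable_comp (F G : Type) (g : F -> G) (f : T -> F) :
  discrete_measurable f -> discrete_measurable (g \o f).
Proof. by move=> mf A; rewrite comp_preimage; exact: mf. Qed.

Lemma discrete_measurable_pair (F : finType) (G : Type) (f : T -> F) (g : T -> G) :
  discrete_measurable f -> discrete_measurable g ->
  discrete_measurable (fun w => (f w, g w)).
Proof.
move=> mf mg A; rewrite (_ : _ @^-1` A = \bigcup_(y in [set: F])
    (f @^-1` [set y] `&` g @^-1` [set z | A (y, z)])).
  by apply: fin_bigcup_measurable => [|y _]; [exact: finite_finset | exact: measurableI].
apply/seteqP; split=> w /=; first by move=> Aw; exists (f w).
by move=> [y _ /= [-> ]].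
Qed.

Lemma discrete_measurable_traj (F : finType) (X : nat -> T -> F) (s : seq nat) :
  (forall t, discrete_measurable (X t)) ->
  discrete_measurable (fun w => [seq X i w | i <- s]).
Proof.
move=> mX; elim: s => [|i s IH] /=.
  move=> A; have [An|An] := pselect (A [::]).
    by rewrite (_ : _ @^-1` _ = setT) //; apply/seteqP; split.
  by rewrite (_ : _ @^-1` _ = set0) //; apply/seteqP; split.
exact: (discrete_measurable_comp (fun z => z.1 :: z.2)
  (discrete_measurable_pair (mX i) IH)).
Qed.

Lemma probability_partition (R : realType) (Pr : probability T R) (n : nat)
    (Y : T -> 'I_n) (A : set T) :
  discrete_measurable Y -> measurable A ->
  Pr A = (\sum_(y < n) Pr (A `&` [set w | Y w = y]))%E.
Proof.
move=> mY mA.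
have AE : A = \big[setU/set0]_(y < n) (A `&` [set w | Y w = y]).
  rewrite -bigcup_seq /=; apply/seteqP; split => w /=.
    by move=> Aw; exists (Y w) => //=; rewrite mem_index_enum.
  by move=> [y _ []].
rewrite {1}AE measure_bigsetU_ord//.
- by move=> y; apply: measurableI => //; exact: (mY [set y]).
- by move=> i j _ _ [w [/= [_ <-] [_ <-]]].
Qed.

End DiscreteMeasurability.

Section MarkovLaw.
Context (R : realType) (d : measure_display) (T : measurableType d).
Variables (Pr : probability T R) (n : nat) (mu : 'rV[R]_n) (Q : 'M[R]_n).
Variable X : nat -> T -> 'I_n.
Hypothesis hX : markov_chain Pr mu Q X.

Let mX t : discrete_measurable (X t).
Proof. by apply: discrete_measurable_fibers => y; case: hX => + _ _; exact. Qed.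

Let history t (x : nat -> 'I_n) := [set w | forall i, (i <= t)%N -> X i w = x i].

Lemma measurable_history t x : measurable (history t x).
Proof.
rewrite (_ : history t x = (fun w => [seq X i w | i <- iota 0 t.+1]) @^-1`
   [set s | s = [seq x i | i <- iota 0 t.+1]]).
  exact: discrete_measurable_traj.
apply/seteqP; split=> w H.
  by apply/(@eq_in_map _ _ (fun i => X i w)) => i; rewrite mem_iota add0n /= ltnS; exact: H.
move=> i it; apply: (proj2 (@eq_in_map _ _ (fun i => X i w) x _) H).
by rewrite mem_iota add0n ltnS.
Qed.

(** Induction on the number [k] of future steps, splitting by the next state. Multiplying by the
    probability of the history instead of conditioning on it covers null histories. *)
Lemma markov_pathE k t x (a : seq 'I_n -> bool) :
  Pr (history t x `&` [set w | a [seq X i w | i <- iota t.+1 k]]) =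
  (Pr (history t x) * (pathE (fun x y => Q x y) k (x t) (fun s => (a s)%:R))%:E)%E.
Proof.
elim: k t x a => [|k IH] t x a /=.
  case: (a [::]) => /=.
    by rewrite (_ : [set _ | _] = setT) ?setIT ?mule1//; apply/seteqP; split.
  by rewrite (_ : [set _ | _] = set0) ?setI0 ?measure0 ?mule0//; apply/seteqP; split.
rewrite (probability_partition Pr (mX t.+1)); last first.
  apply: measurableI; first exact: measurable_history.
  exact: (@discrete_measurable_traj _ _ _ X (t.+1 :: iota t.+2 k) mX [set s | a s]).
have [r hr] : exists r, Pr (history t x) = r%:E.
  exists (fine (Pr (history t x))); rewrite fineK//.
  by apply: fin_num_measure; exact: measurable_history.
rewrite hr -EFinM mulr_sumr -sumEFin; apply: eq_bigr => y _.
pose x' i := if i == t.+1 then y else x i.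
have x't i : (i <= t)%N -> x' i = x i by rewrite /x'; case: eqP => // ->; rewrite ltnn.
have hx' : history t x' = history t x.
  by apply/seteqP; split=> w /= H i it; rewrite H// x't.
have := IH t.+1 x' (fun s => a (y :: s)).
have -> : Pr (history t.+1 x') = (r * Q (x t) y)%:E.
  case: hX => _ _ /(_ t x'); rewrite -/(history t.+1 x') -/(history t x') => ->.
  by rewrite hx' hr x't// /x' eqxx.
rewrite {2}/x' eqxx -EFinM mulrA => <-; congr (Pr _).
apply/seteqP; split=> w /=.
  move=> [[H aw] Xy]; split; last by rewrite -Xy.
  by move=> i; rewrite leq_eqVlt => /predU1P[->|it]; [rewrite /x' eqxx | rewrite x't// H].
move=> [H aw]; have Xy : X t.+1 w = y by rewrite H// /x' eqxx.
by split=> //; split; [move=> i it; rewrite H ?x't// ltnW | rewrite Xy].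
Qed.

(** Turns probabilities on the abstract space into finite sums over paths: the tail bounds are
    proved for [chainE] and transferred by this identity. *)
Lemma markov_chainE k (a : 'I_n -> seq 'I_n -> bool) :
  Pr [set w | a (X 0%N w) [seq X i w | i <- iota 1 k]] =
  (chainE (fun x y => Q x y) (fun x => mu 0 x) k (fun x s => (a x s)%:R))%:E.
Proof.
rewrite (probability_partition Pr (mX 0)); last first.
  exact: (@discrete_measurable_traj _ _ _ X (0%N :: iota 1 k) mX
    [set s | if s is x :: s' then a x s' else false]).
rewrite -sumEFin; apply: eq_bigr => y _.
have := markov_pathE k 0 (fun=> y) (a y).
have h0 : history 0 (fun=> y) = [set w | X 0%N w = y].
  by apply/seteqP; split=> w /= H; [exact: H | case].
have -> : Pr (history 0 (fun=> y)) = (mu 0 y)%:E.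
  by rewrite h0; case: hX => _ /(_ y).
rewrite -EFinM => <-; congr (Pr _); rewrite h0.
by apply/seteqP; split=> w /= [H1 H2]; split=> //; rewrite ?H1// -H2.
Qed.

(** [G] will be the set of states kept by the trimming: with ties broken arbitrarily, it need not be
    a function of the trajectory. *)
Lemma markov_traj_measurable (F : finType) (G : T -> F) k (A : set (F * seq 'I_n)) :
  discrete_measurable G ->
  measurable [set w | A (G w, [seq X i w | i <- iota 0 k])].
Proof.
move=> mG.
exact: (discrete_measurable_pair mG (discrete_measurable_traj (iota 0 k) mX) A).
Qed.

End MarkovLaw.

(** * Mean of the count matrix *)

Section StationaryCounts.
Variables (R : realType) (n : nat) (mu : 'rV[R]_n) (Q : 'M[R]_n).
Hypothesis muQ : mu *m Q = mu.
Hypothesis Q1 : forall x, \sum_y Q x y = 1.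

Local Notation E := (chainE (fun x y => Q x y) (fun x => mu 0 x)).

(** Stationarity: the path without its starting state has the same law. Iterating this brings a
    transition at time [t] back to time 0. *)
Lemma chainE_shift t (F : 'I_n -> seq 'I_n -> R) :
  E t.+1 (fun _ s => if s is y :: s' then F y s' else 0) = E t F.
Proof.
rewrite /chainE /=; under eq_bigr do rewrite mulr_sumr.
rewrite exchange_big; apply: eq_bigr => y _ /=.
under eq_bigr do rewrite mulrA.
by rewrite -mulr_suml -[in RHS]muQ mxE.
Qed.

Lemma chainE_nth t (f : 'I_n -> 'I_n -> R) x0 :
  E t.+1 (fun x s => f (nth x0 (x :: s) t) (nth x0 s t)) =
  \sum_x \sum_y mu 0 x * Q x y * f x y.
Proof.
elim: t => [|t IH].
  rewrite /chainE /=; apply: eq_bigr => x _; rewrite mulr_sumr.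
  by apply: eq_bigr => y _; rewrite mulrA.
by rewrite -IH -[RHS]chainE_shift.
Qed.

Context (d : measure_display) (T : measurableType d).
Variables (Pr : probability T R) (X : nat -> T -> 'I_n).
Hypothesis hX : markov_chain Pr mu Q X.

Lemma stationary_transition_prob t x y :
  Pr [set w | (X t w == x) && (X t.+1 w == y)] = (mu 0 x * Q x y)%:E.
Proof.
have := markov_chainE hX t.+1
  (fun a s => (nth x (a :: s) t == x) && (nth x s t == y)).
rewrite (chainE_nth t (fun a b => ((a == x) && (b == y))%:R) x).
rewrite (bigD1 x)//= (bigD1 y)//= !eqxx mulr1 big1 => [|b /negbTE bn]; last first.
  by rewrite bn mulr0.
rewrite addr0 big1 ?addr0 => [|a /negbTE an]; last by rewrite big1// => b _; rewrite an mulr0.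
move=> <-; congr (Pr _); apply/funext => w /=; congr (is_true (_ && _)); congr (_ == _).
  have t2 : (t < t.+2)%N by lia.
  by rewrite -[_ :: _]/[seq X i w | i <- iota 0 t.+2] (nth_map 0%N) ?size_iota ?nth_iota.
by rewrite -[_ :: _]/[seq X i w | i <- iota 1 t.+1] (nth_map 0%N) ?size_iota ?nth_iota.
Qed.

Lemma expectation_count_mx l x y :
  expectation_mx Pr (fun w => count_mx R l (fun t => X t w)) x y =
  l%:R * mu 0 x * Q x y.
Proof.
have mX t : discrete_measurable (X t).
  by apply: discrete_measurable_fibers => z; case: hX => + _ _; exact.
pose A t := [set w | (X t w == x) && (X t.+1 w == y)].
have PA t : Pr (A t) = (mu 0 x * Q x y)%:E by exact: stationary_transition_prob.
have mA t : measurable (A t).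
  exact: (@discrete_measurable_traj _ _ _ X [:: t; t.+1] mX
    [set s | if s is [:: a; b] then (a == x) && (b == y) else false]).
rewrite mxE unlock (eq_integral (fun w => (\sum_(t < l) (\1_(A t) w)%:E)%E)); last first.
  move=> w _; rewrite mxE -sumEFin; apply: eq_bigr => t _; congr (_%:E).
  rewrite indicE; congr ((nat_of_bool _)%:R); apply/idP/idP.
    by move=> H; rewrite mem_set.
  by rewrite inE.
rewrite ge0_integral_sum//=.
- rewrite (eq_bigr (fun=> (mu 0 x * Q x y)%:E)); last first.
    move=> t _; rewrite integral_indic// setIT. exact: PA.
  by rewrite sumEFin /= sumr_const card_ord -mulrA mulr_natl.
- by move=> t; apply/measurable_EFinP; exact: measurable_indic.
Qed.

End StationaryCounts.

(** * Fluctuations of the cluster transition counts *)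

Section PoissonEquation.
Variables (R : realType) (K : nat) (p : 'M[R]_K) (pi : 'rV[R]_K).
Hypothesis hp : stochastic p.
Hypothesis hirr : irreducible p.
Hypothesis hpi : stationary p pi.

Lemma stochastic_exp m : stochastic (p ^+ m).
Proof.
elim: m => [|m [IH0 IH1]].
  rewrite expr0; split=> [i j|i]; first by rewrite mxE; case: (i == j).
  rewrite (bigD1 i)//= big1 => [|j /negbTE ji]; first by rewrite mxE eqxx addr0.
  by rewrite mxE eq_sym ji.
rewrite exprS; split=> [i j|i].
  by rewrite mxE sumr_ge0// => k _; rewrite mulr_ge0 ?hp.1.
under eq_bigr do rewrite mxE.
rewrite exchange_big -[RHS](hp.2 i); apply: eq_bigr => k _ /=.
by rewrite -mulr_sumr IH1 mulr1.
Qed.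

(* Maximum principle. *)
Lemma harmonic_constant (h : 'cV[R]_K) : p *m h = h -> forall i j, h i 0 = h j 0.
Proof.
move=> ph; have pmh m : p ^+ m *m h = h.
  by elim: m => [|m IH]; rewrite ?expr0 ?mul1mx// exprS -mulmxA IH.
move=> i j; case: (@arg_maxP _ _ _ i xpredT (fun k => h k 0)) => // k _ hk.
suff H i' : h i' 0 = h k 0 by rewrite (H i) (H j).
(* By irreducibility some power of [p] charges [i'] from the maximum point [k]. Under it the
   nonnegative gaps below the maximum average to 0, so the gap at [i'] vanishes. *)
have [m pm] := hirr k i'; have [p0 p1] := stochastic_exp m.
have E : \sum_i (p ^+ m) k i * h i 0 = h k 0 by rewrite -[in RHS](pmh m) mxE.
have : \sum_i (p ^+ m) k i * (h k 0 - h i 0) = 0.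
  under eq_bigr do rewrite mulrBr.
  by rewrite sumrB -mulr_suml p1 mul1r E subrr.
move/psumr_eq0P => H; have /eqP : (p ^+ m) k i' * (h k 0 - h i' 0) = 0.
  by apply: H => // i'' _; rewrite mulr_ge0// subr_ge0; exact: hk.
by rewrite mulf_eq0 gt_eqF//= subr_eq0 => /eqP.
Qed.

(** The matrix [Q], equal to 1 - p + one pi, is invertible: pi Q = pi, so a kernel vector has mean 0
    under pi, hence is harmonic, hence constant, hence 0. The same identity shows that the solution
    of Q h = f has mean 0, so that it solves (1 - p) h = f. *)
Lemma poisson_equation (f : 'I_K -> R) : \sum_k pi 0 k * f k = 0 ->
  exists h : 'I_K -> R, forall i, h i - \sum_j p i j * h j = f i.
Proof.
move=> pif; have [pi0 pi1 pip] := hpi.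
pose one : 'cV[R]_K := const_mx 1; pose fv : 'cV[R]_K := \col_k f k.
have pione : pi *m one = 1%:M.
  by apply/matrixP => i j; rewrite !ord1 !mxE eqxx -[RHS]pi1; apply: eq_bigr => k _; rewrite mxE mulr1.
have pifv : pi *m fv = 0.
  by apply/matrixP => i j; rewrite !ord1 !mxE -[RHS]pif; apply: eq_bigr => k _; rewrite mxE.
have piker : pi *m (1%:M - p) = 0 by rewrite mulmxBr mulmx1 pip subrr.
pose Q : 'M[R]_K := 1%:M - p + one *m pi.
have piQ h : pi *m (Q *m h) = pi *m h.
  by rewrite mulmxA mulmxDr piker add0r mulmxA pione mul1mx.
have Qinj (h : 'cV[R]_K) : Q *m h = 0 -> h = 0.
  move=> Qh; have pih : pi *m h = 0 by rewrite -piQ Qh mulmx0.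
  have ph : p *m h = h.
    move: Qh; rewrite mulmxDl -mulmxA pih mulmx0 addr0 mulmxBl mul1mx => /eqP.
    by rewrite subr_eq0 => /eqP.
  apply/matrixP => i j; rewrite ord1 mxE.
  have /matrixP/(_ 0 0) := pih; rewrite !mxE => <-.
  rewrite -[LHS]mul1r -pi1 mulr_suml; apply: eq_bigr => k _.
  by rewrite (harmonic_constant ph i k).
have Qu : Q \in unitmx.
  rewrite -unitmx_tr -row_free_unit; apply: inj_row_free => v /(congr1 trmx).
  rewrite trmx_mul trmxK trmx0 => /Qinj /(congr1 trmx).
  by rewrite trmxK trmx0.
pose h := invmx Q *m fv; exists (fun i => h i 0) => i.
have Qh : Q *m h = fv by rewrite mulmxA mulmxV// mul1mx.
have pih : pi *m h = 0 by rewrite -piQ Qh.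
have : (1%:M - p) *m h = fv by rewrite -[RHS]Qh [in RHS]mulmxDl -(mulmxA one) pih mulmx0 addr0.
by rewrite mulmxBl mul1mx => /matrixP/(_ i 0); rewrite !mxE.
Qed.

(** With [h a] the solution of the Poisson equation for the centred indicator of [a], and g = p a b
    * h a, adding g (sigma y) - g (sigma x) to the centred indicator of a transition from [a] to [b]
    makes it a martingale increment. The correction telescopes to a bounded term. The constant
    depends only on [p] and [pi]. *)
Lemma cluster_count_variance : exists2 C : R, 0 < C & forall (n : nat)
    (sigma : 'I_n -> 'I_K) (l : nat) (a b : 'I_K),
  (forall k, (0 < #|bmc_cluster sigma k|)%N) -> (0 < l)%N ->
  chainE (fun x y => bmc_transition sigma p x y)
    (fun x => bmc_stationary sigma pi 0 x) l
    (fun x s => (psum (fun x y => ((sigma x == a) && (sigma y == b))%:R) x s -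
       l%:R * (pi 0 a * p a b)) ^+ 2) <= C * l%:R.
Proof.
have [pi0 pi1 pip] := hpi.
have hex a : exists h : 'I_K -> R, forall i, h i - \sum_j p i j * h j = (i == a)%:R - pi 0 a.
  apply: poisson_equation; under eq_bigr do rewrite mulrBr.
  rewrite sumrB -mulr_suml pi1 mul1r (bigD1 a)//= eqxx mulr1 big1 ?addr0 ?subrr//.
  by move=> k /negbTE->; rewrite mulr0.
have [h hh] := choice hex.
pose G : R := \sum_a \sum_i `|h a i|.
have G0 : 0 <= G by rewrite sumr_ge0// => a _; rewrite sumr_ge0.
have hG a i : `|h a i| <= G.
  rewrite /G (bigD1 a)//= (bigD1 i)//= -addrA lerDl addr_ge0 ?sumr_ge0// => j _.
  by rewrite sumr_ge0.
(* An increment is at most 2 + 2 G and the telescoped correction e at most 2 G in absolute value;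
   the constant comes from D^2 <= 2 (D + e)^2 + 2 e^2, and l >= 1 absorbs the last term. *)
exists (2 * (2 + 2 * G) ^+ 2 + 8 * G ^+ 2) => [|n sigma l a b hsurj l0].
  by rewrite ltr_pwDl ?mulr_ge0 ?sqr_ge0// mulr_gt0// exprn_gt0// ltr_pwDl// mulr_ge0.
have pab0 : 0 <= p a b by exact: hp.1.
have pab1 : p a b <= 1 by rewrite -(hp.2 a) (bigD1 b)//= lerDl sumr_ge0// => j _; exact: hp.1.
have pia1 : pi 0 a <= 1 by rewrite -pi1 (bigD1 a)//= lerDl sumr_ge0.
pose g i := p a b * h a i.
have gG i : `|g i| <= G.
  by rewrite normrM ger0_norm// -[leRHS]mul1r ler_pM.
pose phi x y := ((sigma x == a) && (sigma y == b))%:R - pi 0 a * p a b + (g (sigma y) - g (sigma x)).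
set P := fun x y => _; set mu := fun x => _.
have P0 x y : 0 <= P x y by exact: bmc_transition_ge0.
have P1 x : \sum_y P x y = 1 by exact: bmc_transition_sum1.
have mu0 x : 0 <= mu x by exact: bmc_stationary_ge0.
have mu1 : \sum_x mu x = 1 by exact: bmc_stationary_sum1.
have Pf x (F : 'I_K -> R) : \sum_y P x y * F (sigma y) = \sum_j p (sigma x) j * F j.
  rewrite /P; under eq_bigr do rewrite mxE.
  rewrite (sum_cluster_weight sigma (p (sigma x)) (fun y => F (sigma y))); apply: eq_bigr => j _.
  congr (_ * _); rewrite (eq_bigr (fun=> F j * 1)) => [|y /eqP -> //]; last by rewrite mulr1.
  by rewrite -mulr_sumr sum_cluster1 mulfK// gt_eqF// ltr0n.
have phi0 x : \sum_y P x y * phi x y = 0.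
  rewrite (Pf x (fun j => ((sigma x == a) && (j == b))%:R - pi 0 a * p a b + (g j - g (sigma x)))).
  under eq_bigr do rewrite mulrDr mulrBr mulrBr.
  rewrite big_split /= !sumrB -!mulr_suml !hp.2 !mul1r.
  have -> : \sum_j p (sigma x) j * ((sigma x == a) && (j == b))%:R = (sigma x == a)%:R * p a b.
    rewrite (bigD1 b)//= eqxx andbT big1 ?addr0; last by move=> j /negbTE->; rewrite andbF mulr0.
    by case: eqP => [->|_]; rewrite ?mulr1 ?mul1r ?mulr0 ?mul0r.
  have -> : \sum_i p (sigma x) i * g i = p a b * \sum_i p (sigma x) i * h a i.
    by rewrite mulr_sumr; apply: eq_bigr => i _; rewrite mulrCA.
  have := hh a (sigma x); rewrite /g; set S := \sum_j _; set t := _%:R => H.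
  have -> : t = h a (sigma x) - S + pi 0 a by rewrite H; ring.
  ring.
have pp0 : 0 <= pi 0 a * p a b by rewrite mulr_ge0.
have pp1 : pi 0 a * p a b <= 1 by rewrite -[leRHS]mul1r ler_pM.
have phiM x y : phi x y ^+ 2 <= (2 + 2 * G) ^+ 2.
  rewrite -[leLHS]real_normK ?num_real// ler_sqr ?nnegrE ?addr_ge0 ?mulr_ge0//.
  have /andP[u1 u2] : - G <= g (sigma x) <= G by rewrite -ler_norml.
  have /andP[v1 v2] : - G <= g (sigma y) <= G by rewrite -ler_norml.
  rewrite /phi ler_norml.
  by case: ((_ == a) && _); rewrite /= ?mulr1n ?mulr0n; apply/andP; split; lra.
apply: (@le_trans _ _ (chainE P mu l (fun x s => 2 * (0 + psum phi x s) ^+ 2 + 8 * G ^+ 2))).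
  apply: le_chainE => // x s sl.
  have -> : psum phi x s = (psum (fun x y => ((sigma x == a) && (sigma y == b))%:R) x s -
       l%:R * (pi 0 a * p a b)) + (g (sigma (last x s)) - g (sigma x)).
    rewrite -(psum_telescope (fun x => g (sigma x))) -sl mulr_natl -(psum_cst (pi 0 a * p a b) x s).
    elim: s x {sl} => [|y s IHs] x /=; first by rewrite subrr addr0.
    by rewrite IHs /phi; ring.
  have /andP[u1 u2] : - G <= g (sigma x) <= G by rewrite -ler_norml.
  have /andP[v1 v2] : - G <= g (sigma (last x s)) <= G by rewrite -ler_norml.
  set D := _ - _; set v := g (sigma (last x s)); set u := g (sigma x).
  have uv : 0 <= (2 * G - (v - u)) * (2 * G + (v - u)).
    by rewrite mulr_ge0// /u /v; lra.
  rewrite add0r; have := sqr_ge0 (D + 2 * (v - u)); rewrite -subr_ge0.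
  move=> H; rewrite -subr_ge0.
  have -> : 2 * (D + (v - u)) ^+ 2 + 8 * G ^+ 2 - D ^+ 2 =
    ((D + 2 * (v - u)) ^+ 2 - 0) + 2 * ((2 * G - (v - u)) * (2 * G + (v - u))) by ring.
  by rewrite addr_ge0// mulr_ge0.
rewrite chainED chainEZ chainE_cst//.
have : chainE P mu l (fun x s => (0 + psum phi x s) ^+ 2) <= l%:R * (2 + 2 * G) ^+ 2.
  rewrite -[leRHS]mul1r -[X in X * _]mu1 mulr_suml; apply: ler_sum => x _.
  apply: ler_wpM2l => //.
  by have := pathE_sqr_martingale P0 P1 l x 0 phi0 phiM; rewrite expr0n /= add0r.
have l1 : 1 <= l%:R :> R by rewrite ler1n.
by have := sqr_ge0 G; nra.
Qed.

End PoissonEquation.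

(** * A dyadic net for the spectral norm *)

Section DyadicNet.
Variable R : realType.

(** Alphabet of the rounded coordinates: zero, or a sign with a dyadic level. When 4 n < 4^J, the
    [J] levels reach every coordinate of a vector of square norm 4 n. *)
Definition code (J : nat) : Type := option (bool * 'I_J).

Definition cval (J : nat) (c : code J) : R :=
  if c is Some (b, i) then (-1) ^+ b * 2 ^+ i else 0.

Definition norm2 (J n : nat) (z : {ffun 'I_n -> code J}) : R :=
  \sum_x cval (z x) ^+ 2.

Lemma sqr_exp2 J : (2 ^+ J) ^+ 2 = (4 ^ J)%:R :> R.
Proof. by rewrite natrX exprAC; congr (_ ^+ _); ring. Qed.

(** Rounding towards zero to a power of two errs by at most half of [a], and values below 1 are
    replaced by 0 at a cost of at most 1. Rounding towards zero never increases the norm, so the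
    rounded vector stays in the net. *)
Lemma cval_round J (a : R) : `|a| < 2 ^+ J -> exists c : code J,
  cval c ^+ 2 <= a ^+ 2 /\ (a - cval c) ^+ 2 <= a ^+ 2 / 4 + 1.
Proof.
move=> aJ; have [a1|a1] := ltP `|a| 1.
  exists None; rewrite /= expr0n subr0 sqr_ge0; split=> //.
  have : a ^+ 2 <= 1 by rewrite -real_normK ?num_real// expr_le1// ltW.
  by have := sqr_ge0 a; lra.
have [i iJ /andP[ia ai]] : exists2 i, (i < J)%N & 2 ^+ i <= `|a| < 2 ^+ i.+1.
  elim: J aJ => [|J IH] aJ; first by rewrite expr0 ltNge a1 in aJ.
  have [aJ'|Ja] := ltP `|a| (2 ^+ J); last by exists J => //; rewrite Ja.
  by have [i iJ H] := IH aJ'; exists i => //; exact: ltnW.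
exists (Some (a < 0, Ordinal iJ)) => /=.
have i0 : 0 < 2 ^+ i :> R by rewrite exprn_gt0.
rewrite exprS in ai; move: ia ai; set t := 2 ^+ i in i0 *.
have [a0|a0] := ltrP a 0; rewrite ?expr1 ?expr0 => ia ai.
  rewrite ltr0_norm// in ia ai; split; nra.
by rewrite ger0_norm// in ia ai; split; nra.
Qed.

(** Scale [c] to square norm 4 n and round it: the error has square norm at most n + n = 2 n, small
    enough for the rounded vector to remain correlated with [c]. *)
Lemma net_dual (J n : nat) (c : 'I_n -> R) (M : R) : (4 * n < 4 ^ J)%N -> 0 <= M ->
  (forall z : {ffun 'I_n -> code J}, norm2 z <= 4 * n%:R ->
     \sum_x c x * cval (z x) <= M) ->
  n%:R * \sum_x c x ^+ 2 <= 4 * M ^+ 2.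
Proof.
move=> nJ M0 hM; set S := \sum_x _.
have S0 : 0 <= S by rewrite sumr_ge0// => x _; exact: sqr_ge0.
have [S_eq0|S_neq0] := eqVneq S 0; first by rewrite S_eq0 mulr0 mulr_ge0 ?sqr_ge0.
have {}S0 : 0 < S by rewrite lt_neqAle eq_sym S_neq0.
have n0 : 0 < n%:R :> R.
  rewrite ltr0n lt0n; apply: contra S_neq0 => /eqP n0.
  by rewrite /S big1// => x _; have := ltn_ord x; lia.
pose t := Num.sqrt (4 * n%:R / S).
have t0 : 0 < t by rewrite sqrtr_gt0 divr_gt0// mulr_gt0.
have t2 : t ^+ 2 * S = 4 * n%:R.
  by rewrite sqr_sqrtr ?divfK// divr_ge0 ?ltW// mulr_gt0.
have usum : \sum_x (t * c x) ^+ 2 = 4 * n%:R.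
  by under eq_bigr do rewrite exprMn; rewrite -mulr_sumr.
have ubound x : `|t * c x| < 2 ^+ J.
  rewrite -ltr_sqr ?nnegrE ?exprn_ge0// real_normK ?num_real//.
  apply: (@le_lt_trans _ _ (4 * n%:R)).
    by rewrite -usum (bigD1 x)//= lerDl sumr_ge0// => y _; exact: sqr_ge0.
  by rewrite sqr_exp2 -natrM ltr_nat.
have [z hz] := choice (fun x => cval_round (ubound x)).
pose zf := [ffun x => z x].
have zM : \sum_x c x * cval (z x) <= M.
  have zfE x : zf x = z x by rewrite ffunE.
  rewrite (eq_bigr (fun x => c x * cval (zf x))) => [|x _]; last by rewrite zfE.
  apply: hM; rewrite /norm2; under eq_bigr do rewrite zfE.
  by rewrite -usum; apply: ler_sum => x _; exact: (hz x).1.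
have rsum : \sum_x (t * c x - cval (z x)) ^+ 2 <= 2 * n%:R.
  apply: (@le_trans _ _ (\sum_x ((t * c x) ^+ 2 / 4 + 1))).
    by apply: ler_sum => x _; exact: (hz x).2.
  by rewrite big_split /= -mulr_suml usum sumr_const card_ord; lra.
(* Weighted inequality of the means with weights 3/8 and 2/3, of product 1/4. The error costs (3/8 +
   1/3) t S, and 7/24 t S <= M is left. *)
have main : t * S <= M + (3 / 8 * t * S + 2 / 3 / t * (2 * n%:R)).
  have -> : t * S = \sum_x c x * cval (z x) + \sum_x c x * (t * c x - cval (z x)).
    rewrite -big_split mulr_sumr; apply: eq_bigr => x _ /=; ring.
  apply: lerD => //; apply: (@le_trans _ _ (\sum_x (3 / 8 * t * c x ^+ 2 +
      2 / 3 / t * (t * c x - cval (z x)) ^+ 2))).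
    apply: ler_sum => x _; set r := _ - _.
    have -> : 3 / 8 * t * c x ^+ 2 + 2 / 3 / t * r ^+ 2 =
      c x * r + 2 / (3 * t) * (3 / 4 * t * c x - r) ^+ 2.
      by field; rewrite gt_eqF.
    by rewrite lerDl mulr_ge0 ?sqr_ge0// divr_ge0// mulr_ge0// ltW.
  rewrite big_split /= -!mulr_sumr lerD2l ler_wpM2l//.
  by rewrite divr_ge0// ltW.
have nt : 2 / 3 / t * (2 * n%:R) = t * S / 3.
  have -> : n%:R = t ^+ 2 * S / 4 :> R by rewrite t2; field.
  by field; rewrite gt_eqF.
have tS4 : t * S <= 4 * M by rewrite nt in main; have : 0 < t * S by [rewrite mulr_gt0]; lra.
have : (t * S) ^+ 2 <= (4 * M) ^+ 2 by rewrite ler_sqr ?nnegrE ?mulr_ge0// ltW.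
by rewrite expr2 mulrACA -expr2 mulrA t2; nra.
Qed.

(** Two applications of the dual bound, one for each index, pass from the net to all vectors. An
    eigenvector v of B^T B for a > 0 gives w = v B^T with |w B|^2 = a |w|^2, so the bound on w B is
    a bound on a. *)
Lemma sigma1_le_net (J n : nat) (B : 'M[R]_n) (M : R) : (0 < n)%N ->
  (4 * n < 4 ^ J)%N -> 0 < M ->
  (forall z z' : {ffun 'I_n -> code J}, norm2 z <= 4 * n%:R -> norm2 z' <= 4 * n%:R ->
     \sum_x \sum_y B x y * (cval (z x) * cval (z' y)) <= M) ->
  sigma1 B <= 4 * M / n%:R.
Proof.
move=> n0 nJ M0 hM; have nR : 0 < n%:R :> R by rewrite ltr0n.
have bound0 : 0 <= 4 * M / n%:R by rewrite divr_ge0 ?mulr_ge0 ?ltW.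
have step (u : 'I_n -> R) : \sum_x u x ^+ 2 <= 4 * n%:R ->
    n%:R * \sum_y (\sum_x u x * B x y) ^+ 2 <= 4 * (4 * M) ^+ 2.
  move=> hu; apply: (@net_dual J) => //; first by rewrite mulr_ge0// ltW.
  move=> z' hz'; pose c x := \sum_y B x y * cval (z' y).
  have hc : n%:R * \sum_x c x ^+ 2 <= 4 * M ^+ 2.
    apply: (@net_dual J) => //; first exact: ltW.
    move=> z hz; apply: le_trans (hM z z' hz hz'); apply: ler_sum => x _.
    by rewrite mulr_suml le_eqVlt; apply/orP; left; apply/eqP; apply: eq_bigr => y _; ring.
  have -> : \sum_y (\sum_x u x * B x y) * cval (z' y) = \sum_x u x * c x.
    under eq_bigr do rewrite mulr_suml.
    rewrite exchange_big; apply: eq_bigr => x _; rewrite mulr_sumr.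
    by apply: eq_bigr => y _; rewrite mulrA.
  (* These weights balance the two norms: each of the two sums contributes at most 2 M. *)
  apply: (@le_trans _ _ (\sum_x (M / (2 * n%:R) * u x ^+ 2 + n%:R / (2 * M) * c x ^+ 2))).
    apply: ler_sum => x _.
    have -> : M / (2 * n%:R) * u x ^+ 2 + n%:R / (2 * M) * c x ^+ 2 =
        u x * c x + (M * u x - n%:R * c x) ^+ 2 / (2 * M * n%:R).
      by field; rewrite !gt_eqF.
    by rewrite lerDl divr_ge0 ?sqr_ge0// !mulr_ge0// ltW.
  rewrite big_split /= -!mulr_sumr.
  have h1 : M / (2 * n%:R) * \sum_x u x ^+ 2 <= M / (2 * n%:R) * (4 * n%:R).
    by rewrite ler_wpM2l// divr_ge0 ?mulr_ge0// ltW.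
  have h2 : n%:R / (2 * M) * \sum_x c x ^+ 2 <= 2 * M.
    have -> : n%:R / (2 * M) * \sum_x c x ^+ 2 = (n%:R * \sum_x c x ^+ 2) / (2 * M).
      by rewrite mulrAC.
    by rewrite ler_pdivrMr ?mulr_gt0//; apply: le_trans hc _; rewrite le_eqVlt; apply/orP; left; apply/eqP; ring.
  have e1 : M / (2 * n%:R) * (4 * n%:R) = 2 * M by field; rewrite gt_eqF.
  by rewrite e1 in h1; lra.
have eig a : eigenvalue (B^T *m B) a -> Num.sqrt a <= 4 * M / n%:R.
  move=> /eigenvalueP[v hv v0].
  have [a0|a0] := lerP a 0; first by rewrite ler0_sqrtr.
  pose w := v *m B^T.
  have wB : w *m B = a *: v by rewrite -mulmxA hv.
  pose sq (x : 'rV[R]_n) := \sum_i x 0 i ^+ 2.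
  have sqE x : sq x = (x *m x^T) 0 0.
    by rewrite mxE; apply: eq_bigr => i _; rewrite mxE expr2.
  have v20 : 0 < sq v.
    rewrite lt_neqAle sumr_ge0 ?andbT => [|i _]; last exact: sqr_ge0.
    rewrite eq_sym; apply: contra v0 => /eqP/psumr_eq0P H; apply/eqP/rowP => i.
    have /eqP := H (fun i _ => sqr_ge0 (v 0 i)) i isT.
    by rewrite sqrf_eq0 => /eqP ->; rewrite mxE.
  have sqw : sq w = a * sq v.
    by rewrite !sqE /w trmx_mul trmxK mulmxA -(mulmxA v) hv -scalemxAl mxE.
  have w20 : 0 < sq w by rewrite sqw mulr_gt0.
  have sqwB : sq (w *m B) = a * sq w.
    rewrite wB sqw /sq !mulr_sumr; apply: eq_bigr => i _.
    by rewrite mxE; ring.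
  pose s := Num.sqrt (4 * n%:R / sq w).
  have s2 : s ^+ 2 = 4 * n%:R / sq w by rewrite sqr_sqrtr// divr_ge0 ?ltW// mulr_gt0.
  have := step (fun x => s * w 0 x); rewrite (eq_bigr (fun x => s ^+ 2 * w 0 x ^+ 2)) => [|x _]; last by rewrite exprMn.
  rewrite -mulr_sumr s2 -/(sq w) divfK ?gt_eqF// => /(_ (lexx _)).
  have -> : \sum_y (\sum_x s * w 0 x * B x y) ^+ 2 = s ^+ 2 * sq (w *m B).
    rewrite mulr_sumr; apply: eq_bigr => y _; rewrite mxE -exprMn mulr_sumr.
    by congr (_ ^+ 2); apply: eq_bigr => x _; rewrite mulrA.
  rewrite s2 sqwB => H.
  rewrite -(ger0_norm bound0) -sqrtr_sqr ler_wsqrtr// expr_div_n.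
  rewrite ler_pdivlMr ?exprn_gt0//.
  have e : n%:R * (4 * n%:R / sq w * (a * sq w)) = 4 * (a * n%:R ^+ 2).
    by field; rewrite gt_eqF.
  by rewrite e ler_pM2l in H.
rewrite /sigma1; set A := [set _ | _ in _].
(* The supremum of the empty set is 0 by convention, so this case also satisfies the bound. *)
have [->|/set0P A0] := eqVneq A set0; first by rewrite sup0.
by apply: ge_sup => // _ [a /= ha <-]; exact: eig.
Qed.

End DyadicNet.

(** * Heavy pairs and the discrepancy property *)

Section GeometricSums.
Variable R : realType.

(** The sum is of the order of its last term. The induction step needs N >= 1, which is why the
    passage from 0 to 1 is treated apart. *)
Lemma sum_exp2_div (N : nat) :
  \sum_(k < N) 2 ^+ k.+1 / k.+1%:R <= 6 * 2 ^+ N / N.+1%:R :> R.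
Proof.
elim: N => [|N IH]; first by rewrite big_ord0 divr_ge0.
rewrite big_ord_recr /=; case: N IH => [|N] IH; first by rewrite big_ord0 add0r expr1; lra.
apply: le_trans (lerD IH (lexx _)) _.
have t0 : 0 < 2 ^+ N :> R by rewrite exprn_gt0.
have N0 : 0 <= N%:R :> R by rewrite ler0n.
rewrite !exprS -[N.+3%:R]natr1 -[N.+2%:R]natr1 -[N.+1%:R]natr1.
set T := 2 ^+ N in t0 *; set M := N%:R in N0 *; rewrite -subr_ge0.
have -> : 6 * (2 * (2 * T)) / (M + 1 + 1 + 1) - (6 * (2 * T) / (M + 1 + 1) +
    2 * (2 * T) / (M + 1 + 1)) = 8 * T * M / ((M + 1 + 1) * (M + 1 + 1 + 1)).
  by field; apply/andP; split; lra.
by rewrite divr_ge0 ?mulr_ge0// ?ltW//; lra.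
Qed.

(** For fixed [j] the number k = i + j - m takes distinct values with 1 <= k < 2 j, and the sum is
    governed by the largest of them. The gain 1 / (j + 1) will cancel the factor j + 1 in the cost
    of a set at level [j]. *)
Lemma sum_exp2_window (J j m : nat) :
  \sum_(i < J | (m < i + j)%N && (i < j + m)%N) 2 ^+ (i + j) / (i + j - m)%:R
   <= 6 * 2 ^+ m * 4 ^+ j / j.+1%:R :> R.
Proof.
pose f k : R := 2 ^+ k.+1 / k.+1%:R.
have f0 k : 0 <= f k by rewrite divr_ge0 ?exprn_ge0.
apply: (@le_trans _ _ (2 ^+ m * \sum_(k < j.*2) f k)).
  apply: (@le_trans _ _ (\sum_(i < J) \sum_(k < j.*2) 2 ^+ m * f k * (i + j == m + k.+1)%N%:R)).
    rewrite big_mkcond; apply: ler_sum => i _; case: ifPn => [/andP[mi ij]|_]; last first.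
      by rewrite sumr_ge0// => k _; rewrite !mulr_ge0 ?exprn_ge0.
    have kj : (i + j - m.+1 < j.*2)%N by lia.
    rewrite (bigD1 (Ordinal kj))//= (_ : (i + j == m + (i + j - m.+1).+1)%N); last by lia.
    rewrite mulr1 /f (_ : (i + j - m.+1).+1 = i + j - m)%N; last by lia.
    rewrite mulrA -exprD (_ : (m + (i + j - m) = i + j)%N); last by lia.
    by rewrite lerDl sumr_ge0// => k _; rewrite !mulr_ge0 ?exprn_ge0.
  rewrite exchange_big mulr_sumr; apply: ler_sum => k _ /=.
  rewrite -mulr_sumr -[leRHS]mulr1 ler_wpM2l ?mulr_ge0 ?exprn_ge0//.
  have [/existsP[i0 /eqP hi]|/existsPn H] := boolP [exists i : 'I_J, (i + j == m + k.+1)%N].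
    rewrite (bigD1 i0)//= hi eqxx big1 ?addr0// => i ii.
    by case: eqP => // hi'; case/eqP: ii; apply: val_inj => /=; lia.
  by rewrite big1// => i _; rewrite (negbTE (H i)).
rewrite [6 * _]mulrC -[leRHS]mulrA -mulrA ler_wpM2l ?exprn_ge0//.
apply: le_trans (sum_exp2_div _) _.
have -> : 2 ^+ j.*2 = 4 ^+ j :> R by rewrite -mul2n exprM; congr (_ ^+ _); ring.
rewrite mulrA ler_wpM2l ?mulr_ge0 ?exprn_ge0// lef_pV2 ?posrE ?ltr0n// ler_nat; lia.
Qed.

Lemma sum_exp4 J : 3 * \sum_(j < J) 4 ^+ j <= 4 ^+ J :> R.
Proof.
elim: J => [|J IH]; first by rewrite big_ord0 mulr0 exprn_ge0.
by rewrite big_ord_recr /= mulrDr exprS; lra.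
Qed.

Lemma sum_exp4V J : \sum_(j < J) 4 ^+ j / 16 ^+ j.+1 <= 1 :> R.
Proof.
suff : \sum_(j < J) 4 ^+ j / 16 ^+ j.+1 <= 1 - 4 ^- J :> R.
  by move/le_trans; apply; rewrite gerBl invr_ge0 exprn_ge0.
elim: J => [|J IH]; first by rewrite big_ord0 expr0 invr1 subrr.
rewrite big_ord_recr /=; apply: le_trans (lerD IH (lexx _)) _.
have t0 : 0 < 4 ^+ J :> R by rewrite exprn_gt0.
have -> : 16 ^+ J.+1 = 16 * (4 ^+ J) ^+ 2 :> R.
  by rewrite exprS exprAC; congr (_ * _ ^+ _); ring.
have -> : 4 ^+ J / (16 * (4 ^+ J) ^+ 2) = (4 ^+ J)^-1 / 16 :> R by field; lra.
rewrite exprS invfM.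
by have : 0 < (4 ^+ J)^-1 :> R; [rewrite invr_gt0 | lra].
Qed.

End GeometricSums.

Section DeterministicBound.
Variables (R : realType) (K n : nat) (sigma : 'I_n -> 'I_K).
Variables (l m J : nat) (B r : R).
Hypothesis n0 : (0 < n)%N.
Hypothesis hl : (4 ^ m * n <= l < 4 ^ m.+1 * n)%N.
Hypothesis hJ : (4 * n < 4 ^ J <= 16 * n)%N.
Hypothesis B1 : 1 <= B.
Hypothesis r0 : 0 <= r.

Local Notation v k := (#|bmc_cluster sigma k|%:R : R).
Local Notation val c := (cval R c).
Local Notation net := {ffun 'I_n -> code J}.

Let nR : 0 < n%:R :> R. Proof. by rewrite ltr0n. Qed.
Let B0 : 0 <= B. Proof. exact: le_trans B1. Qed.
Let nR0 : 0 <= n%:R :> R. Proof. exact: ltW. Qed.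
Let l_le : l%:R <= 4 * (2 ^+ m) ^+ 2 * n%:R :> R.
Proof.
have [_ /ltnW] := andP hl; rewrite -(ler_nat R) natrM expnS natrM.
by rewrite sqr_exp2.
Qed.

Definition lightF (z z' : net) (x y : 'I_n) : R :=
  if `|val (z x) * val (z' y)| <= 2 ^+ m then val (z x) * val (z' y) else 0.

Definition cluster_count (C : 'I_n -> 'I_n -> R) (a b : 'I_K) : R :=
  \sum_(x | sigma x == a) \sum_(y | sigma y == b) C x y.

(** Mean of the counts given the cluster sequence: the transitions of a block are spread evenly over
    it. *)
Definition cluster_mean (C : 'I_n -> 'I_n -> R) (x y : 'I_n) : R :=
  cluster_count C (sigma x) (sigma y) / (v (sigma x) * v (sigma y)).

Definition edges (C : 'I_n -> 'I_n -> R) (S T : {set 'I_n}) : R :=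
  \sum_(x in S) \sum_(y in T) C x y.

(* Cost of a set of s states at level i in the union bound; the first two terms
   make the sum over all sets of exp (- cost) at most exp (- i - 1 - r). *)
Definition level_cost (i s : nat) : R :=
  4 * i.+1%:R * s%:R + n%:R / 16 ^+ i.+1 + (i.+1%:R + r).

(** Logarithmic form of a Chernoff bound with parameter k / 4, k = i + j - m. The first term on the
    right bounds the exponential moment, with B^2 / n^2 bounding the density of a pair of states;
    the costs pay for the choice of both sets and levels. *)
Definition discrepancy (C : 'I_n -> 'I_n -> R) (i j : nat) (S T : {set 'I_n}) : Prop :=
  (i + j - m)%:R / 4 * edges C S T <=
  2^-1 * (2 ^+ (i + j - m) * B ^+ 2 * l%:R * (#|S|%:R * #|T|%:R) / n%:R ^+ 2) +
  (level_cost i #|S| + level_cost j #|T|).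

Definition lset (z : net) (i : 'I_J) : {set 'I_n} :=
  [set x | if z x is Some (_, i') then i' == i else false].

Lemma sum_lset (z : net) (F : 'I_J -> 'I_n -> R) :
  \sum_i \sum_(x in lset z i) F i x =
  \sum_x (if z x is Some (_, i) then F i x else 0).
Proof.
under eq_bigr do rewrite big_mkcond.
rewrite exchange_big; apply: eq_bigr => x _ /=.
case zx: (z x) => [[b i]|]; last by rewrite big1// => i _; rewrite inE zx.
rewrite (bigD1 i)//= inE zx eqxx big1 ?addr0// => j ji.
by rewrite inE zx eq_sym (negbTE ji).
Qed.

Lemma cval_sqr (b : bool) (i : 'I_J) : val (Some (b, i) : code J) ^+ 2 = 4 ^+ i.
Proof.
by rewrite /= exprMn sqrr_sign mul1r exprAC; congr (_ ^+ _); ring.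
Qed.

Lemma norm2_lset (z : net) : \sum_(i < J) 4 ^+ i * #|lset z i|%:R = norm2 R z.
Proof.
under eq_bigr do rewrite mulr_natr -sumr_const.
rewrite (sum_lset z (fun i _ => 4 ^+ i)); apply: eq_bigr => x _.
by case: (z x) => [[b i]|]; rewrite ?cval_sqr// /= expr0n.
Qed.

Lemma level_cost_ge0 i s : 0 <= level_cost i s.
Proof. by rewrite /level_cost !addr_ge0 ?mulr_ge0 ?divr_ge0 ?exprn_ge0. Qed.

(** The three terms of the cost contribute 4 times the square norm, at most 16 n; a geometric
    series, at most n; and (1 + r) times a sum of powers of 4, at most 16 n. *)
Lemma sum_level_cost (z : net) : norm2 R z <= 4 * n%:R ->
  \sum_(j < J) 4 ^+ j / j.+1%:R * level_cost j #|lset z j| <= (33 + 16 * r) * n%:R.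
Proof.
move=> hz; apply: (@le_trans _ _ (\sum_(j < J) (4 * (4 ^+ j * #|lset z j|%:R) +
    n%:R * (4 ^+ j / 16 ^+ j.+1) + (1 + r) * 4 ^+ j))).
  apply: ler_sum => j _; rewrite /level_cost.
  have j0 : 0 < j.+1%:R :> R by rewrite ltr0n.
  have j1 : 1 <= j.+1%:R :> R by rewrite ler1n.
  have t0 : 0 < 4 ^+ j :> R by rewrite exprn_gt0.
  have V1 : j.+1%:R^-1 <= 1 :> R by rewrite invf_le1.
  rewrite !mulrDr; apply: lerD; first apply: lerD.
  - by rewrite le_eqVlt; apply/orP; left; apply/eqP; field; rewrite gt_eqF.
  - set q := 16 ^+ _; have q0 : 0 < q by rewrite exprn_gt0.
    rewrite mulrCA; apply: ler_wpM2l; first exact: ltW.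
    rewrite mulrAC; rewrite ger_pMr ?divr_gt0//.
  - rewrite -mulrDr mulrDl mul1r [r * _]mulrC.
    have -> : 4 ^+ j / j.+1%:R * (j.+1%:R + r) = 4 ^+ j + 4 ^+ j * (j.+1%:R^-1 * r).
      by field; rewrite gt_eqF.
    rewrite lerD2l; apply: ler_wpM2l; first exact: ltW.
    by rewrite -[leRHS]mul1r ler_wpM2r.
rewrite !big_split /= -!mulr_sumr norm2_lset.
have h1 := sum_exp4V R J; have h2 := sum_exp4 R J.
have h3 : 4 ^+ J <= 16 * n%:R :> R.
  by have [_] := andP hJ; rewrite -(ler_nat R) natrX natrM.
set s1 := \sum_(j < J) (4 ^+ j / 16 ^+ j.+1) in h1 *; set s2 := \sum_(j < J) 4 ^+ j in h2 *.
have s2n : s2 <= 16 * n%:R by move: h2 h3 nR; lra.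
have : n%:R * s1 <= n%:R * 1 by rewrite ler_wpM2l// ltW.
have : (1 + r) * s2 <= (1 + r) * (16 * n%:R) by apply: ler_wpM2l => //; move: r0; lra.
by move: hz; lra.
Qed.

(** Pairs of levels with product above 2^m and ratio strictly between 2^-m and 2^m, for which the
    degree bounds do not suffice. *)
Definition window (i j : nat) := [&& m < i + j, i < j + m & j < i + m]%N.

(** Multiply the discrepancy bound by 4 * 2^(i+j) / k. In the mean term, 2^(i+j) 2^k = 4^i 4^j / 2^m
    produces the product of the square norms, and k >= 1 is enough. In the cost terms the sum over
    the other level comes first, and leaves 24 * 2^m times the weighted sum of costs, once for each
    side. *)
Lemma sum_window (C : 'I_n -> 'I_n -> R) (z z' : net) :
  norm2 R z <= 4 * n%:R -> norm2 R z' <= 4 * n%:R ->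
  (forall (i j : 'I_J) (S T : {set 'I_n}), (m < i + j)%N -> discrepancy C i j S T) ->
  \sum_(i < J) \sum_(j < J | window i j) 2 ^+ (i + j) * edges C (lset z i) (lset z' j)
  <= (128 * B ^+ 2 + 48 * (33 + 16 * r)) * (2 ^+ m * n%:R).
Proof.
move=> hz hz' disc; pose t : R := 2 ^+ m.
have t0 : 0 < t by rewrite exprn_gt0.
have t1 := ltW t0.
pose a (i : 'I_J) : R := 4 ^+ i * #|lset z i|%:R; pose a' (j : 'I_J) : R := 4 ^+ j * #|lset z' j|%:R.
pose c (i j : 'I_J) : R := 4 * (2 ^+ (i + j) / (i + j - m)%:R).
pose w (i : 'I_J) := level_cost i #|lset z i|; pose w' (j : 'I_J) := level_cost j #|lset z' j|.
have c0 i j : 0 <= c i j by rewrite mulr_ge0// divr_ge0// exprn_ge0.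
have a0 i : 0 <= a i by rewrite mulr_ge0// exprn_ge0.
have a'0 i : 0 <= a' i by rewrite mulr_ge0// exprn_ge0.
apply: (@le_trans _ _ (\sum_(i < J) \sum_(j < J)
    2 * B ^+ 2 * l%:R / n%:R ^+ 2 / t * (a i * a' j) +
  (\sum_(i < J) \sum_(j < J | (m < j + i)%N && (j < i + m)%N) c i j * w i +
   \sum_(i < J) \sum_(j < J | (m < i + j)%N && (i < j + m)%N) c i j * w' j))).
  rewrite -!big_split; apply: ler_sum => i _ /=.
  rewrite (big_mkcond (fun j : 'I_J => window i j)).
  rewrite [X in _ <= _ + (X + _)]big_mkcond [X in _ <= _ + (_ + X)]big_mkcond.
  rewrite -!big_split; apply: ler_sum => j _ /=.
  have X0 : 0 <= 2 * B ^+ 2 * l%:R / n%:R ^+ 2 / t * (a i * a' j).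
    by rewrite !mulr_ge0 ?invr_ge0 ?exprn_ge0.
  have cw0 : 0 <= c i j * w i by rewrite mulr_ge0// level_cost_ge0.
  have cw'0 : 0 <= c i j * w' j by rewrite mulr_ge0// level_cost_ge0.
  rewrite /window (addnC j i).
  have [mij|_] := boolP (m < i + j)%N; last by rewrite /= !addr0.
  case: (boolP (i < j + m)%N) => [ij|_]; last by rewrite /= addr0 addr_ge0//; case: ifP.
  case: (boolP (j < i + m)%N) => [ji|_]; last by rewrite /= add0r addr_ge0.
  rewrite /= -mulrDr.
  have := disc i j (lset z i) (lset z' j) mij; rewrite /discrepancy.
  set e := edges _ _ _; rewrite -/(w i) -/(w' j) => H.
  have k0 : 0 < (i + j - m)%:R :> R by rewrite ltr0n subn_gt0.
  have k1 : 1 <= (i + j - m)%:R :> R by rewrite ler1n subn_gt0.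
  have -> : 2 ^+ (i + j) * e = c i j * ((i + j - m)%:R / 4 * e).
    by rewrite /c; field; rewrite gt_eqF.
  apply: le_trans (ler_wpM2l (c0 i j) H) _.
  rewrite [in leLHS]mulrDr lerD2r.
  have e1 : 2 ^+ (i + j - m) = 2 ^+ (i + j) / t :> R.
    by rewrite -[in RHS](subnK (ltnW mij)) exprD mulfK// gt_eqF.
  have e2 : 4 ^+ i * 4 ^+ j = 2 ^+ (i + j) * 2 ^+ (i + j) :> R.
    rewrite -expr2 -exprD -exprM mulnC exprM; congr (_ ^+ _); ring.
  have -> : a i * a' j = 2 ^+ (i + j) * 2 ^+ (i + j) * (#|lset z i|%:R * #|lset z' j|%:R).
    by rewrite -e2 /a /a'; ring.
  rewrite e1 /c; set Y := 2 ^+ (i + j); set s1 := #|_|%:R; set s2 := #|_|%:R.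
  have -> : 4 * (Y / (i + j - m)%:R) * (2^-1 * (Y / t * B ^+ 2 * l%:R * (s1 * s2) / n%:R ^+ 2)) =
     (2 * B ^+ 2 * l%:R / n%:R ^+ 2 / t * (Y * Y * (s1 * s2))) / (i + j - m)%:R.
    by field; rewrite !gt_eqF.
  rewrite ler_pdivrMr// -[leLHS]mulr1 ler_wpM2l//.
  by rewrite !mulr_ge0 ?invr_ge0 ?exprn_ge0.
have A1 : \sum_(i < J) \sum_(j < J) 2 * B ^+ 2 * l%:R / n%:R ^+ 2 / t * (a i * a' j) <=
    128 * B ^+ 2 * (t * n%:R).
  under eq_bigr do rewrite -mulr_sumr -mulr_sumr.
  rewrite -mulr_sumr -mulr_suml !norm2_lset.
  have na0 : 0 <= norm2 R z by rewrite sumr_ge0// => x _; exact: sqr_ge0.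
  have na'0 : 0 <= norm2 R z' by rewrite sumr_ge0// => x _; exact: sqr_ge0.
  apply: (@le_trans _ _ (2 * B ^+ 2 * (4 * t ^+ 2 * n%:R) / n%:R ^+ 2 / t * (4 * n%:R * (4 * n%:R)))).
    apply: ler_pM; [by rewrite !mulr_ge0 ?invr_ge0 ?exprn_ge0|by rewrite mulr_ge0| |by apply: ler_pM].
    do 2! (apply: ler_wpM2r; first by rewrite invr_ge0 ?exprn_ge0).
    by apply: ler_wpM2l => //; rewrite mulr_ge0 ?sqr_ge0.
  by rewrite le_eqVlt; apply/orP; left; apply/eqP; field; rewrite !gt_eqF.
have A2 (u : net) : norm2 R u <= 4 * n%:R ->
    \sum_(i < J) \sum_(j < J | (m < j + i)%N && (j < i + m)%N) 4 * (2 ^+ (j + i) / (j + i - m)%:R) *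
    level_cost i #|lset u i| <= 24 * (33 + 16 * r) * (t * n%:R).
  move=> hu; apply: (@le_trans _ _ (\sum_(i < J) 24 * t * (4 ^+ i / i.+1%:R * level_cost i #|lset u i|))).
    apply: ler_sum => i _; rewrite -mulr_suml mulrA ler_wpM2r ?level_cost_ge0//.
    rewrite -mulr_sumr; have := sum_exp2_window R J i m; rewrite -/t; set s := \sum_(_ | _) _.
    have -> : 24 * t * (4 ^+ i / i.+1%:R) = 4 * (6 * t * 4 ^+ i / i.+1%:R) by ring.
    by move=> H; rewrite ler_wpM2l.
  rewrite -mulr_sumr; have -> : 24 * (33 + 16 * r) * (t * n%:R) = 24 * t * ((33 + 16 * r) * n%:R) by ring.
  by rewrite ler_wpM2l ?sum_level_cost// mulr_ge0// ltW.
have A3 := A2 z hz; have A4 := A2 z' hz'.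
rewrite (_ : \sum_(i < J) \sum_(j < J | (m < i + j)%N && (i < j + m)%N) c i j * w' j =
  \sum_(i < J) \sum_(j < J | (m < j + i)%N && (j < i + m)%N) 4 * (2 ^+ (j + i) / (j + i - m)%:R) *
    level_cost i #|lset z' i|); last first.
  by rewrite (exchange_big_dep xpredT).
rewrite (_ : \sum_(i < J) \sum_(j < J | (m < j + i)%N && (j < i + m)%N) c i j * w i =
  \sum_(i < J) \sum_(j < J | (m < j + i)%N && (j < i + m)%N) 4 * (2 ^+ (j + i) / (j + i - m)%:R) *
    level_cost i #|lset z i|); last first.
  by apply: eq_bigr => i _; apply: eq_bigr => j _; rewrite /c (addnC j).
apply: le_trans (lerD A1 (lerD A3 A4)) _; rewrite -/t le_eqVlt.
by apply/orP; left; apply/eqP; ring.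
Qed.

End DeterministicBound.

(** * Spectral norm of the trimmed matrix for a good path *)

Section TrimmedBound.
Variables (R : realType) (K n : nat) (sigma : 'I_n -> 'I_K).
Variables (l m J : nat) (B r Delta L H : R).
Hypothesis n0 : (0 < n)%N.
Hypothesis hl : (4 ^ m * n <= l < 4 ^ m.+1 * n)%N.
Hypothesis hJ : (4 * n < 4 ^ J <= 16 * n)%N.
Hypothesis B1 : 1 <= B.
Hypothesis hB : forall k, n%:R <= B * #|bmc_cluster sigma k|%:R.
Hypothesis r0 : 0 <= r.
Hypothesis Delta0 : 0 <= Delta.
Hypothesis L0 : 0 <= L.
Hypothesis H0 : 0 <= H.

Local Notation v k := (#|bmc_cluster sigma k|%:R : R).
Local Notation val c := (cval R c).
Local Notation net := {ffun 'I_n -> code J}.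
Local Notation t := (2 ^+ m : R).

Let nR : 0 < n%:R :> R. Proof. by rewrite ltr0n. Qed.
Let nR0 : 0 <= n%:R :> R. Proof. exact: ltW. Qed.
Let B0 : 0 <= B. Proof. exact: le_trans B1. Qed.
Let t_gt0 : 0 < t. Proof. by rewrite exprn_gt0. Qed.
Let t_ge0 : 0 <= t. Proof. exact: ltW. Qed.
Let t_ge1 : 1 <= t. Proof. by rewrite exprn_ege1// ler1n. Qed.
Let v0 k : 0 < v k.
Proof.
have := lt_le_trans nR (hB k); rewrite pmulr_rgt0//; exact: lt_le_trans B1.
Qed.
Let l_le : l%:R <= 4 * t ^+ 2 * n%:R :> R.
Proof.
have [_ /ltnW] := andP hl; rewrite -(ler_nat R) natrM expnS natrM.
by rewrite sqr_exp2.
Qed.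

Lemma inv_cluster_le a b : (v a * v b)^-1 <= B ^+ 2 / n%:R ^+ 2.
Proof.
have q : 0 < B ^+ 2 / n%:R ^+ 2.
  by rewrite divr_gt0 ?exprn_gt0//; exact: lt_le_trans B1.
rewrite -[leRHS]invrK lef_pV2 ?posrE ?mulr_gt0 ?invr_gt0//.
rewrite invf_div ler_pdivrMr ?exprn_gt0//; last exact: lt_le_trans B1.
have := ler_pM nR0 nR0 (hB a) (hB b); rewrite -expr2.
by move=> h; apply: le_trans h _; rewrite le_eqVlt; apply/orP; left; apply/eqP; ring.
Qed.

Variable C : 'M[R]_n.
Hypothesis C0 : forall x y, 0 <= C x y.
Hypothesis Ctot : \sum_x \sum_y C x y <= l%:R.

Local Notation Nt := (cluster_mean sigma (fun x y => C x y)).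

Lemma cluster_count_le a b : 0 <= cluster_count sigma (fun x y => C x y) a b <= l%:R.
Proof.
apply/andP; split; first by rewrite sumr_ge0// => x _; rewrite sumr_ge0.
apply: le_trans Ctot; rewrite /cluster_count big_mkcond; apply: ler_sum => x _.
case: ifP => _; last by rewrite sumr_ge0.
by rewrite big_mkcond; apply: ler_sum => y _; case: ifP.
Qed.

Lemma cluster_mean_le x y : 0 <= Nt x y <= l%:R * (B ^+ 2 / n%:R ^+ 2).
Proof.
have /andP[h1 h2] := cluster_count_le (sigma x) (sigma y).
rewrite /cluster_mean divr_ge0 ?mulr_ge0//=.
by rewrite ler_pM ?invr_ge0 ?mulr_ge0// inv_cluster_le.
Qed.

Lemma sum_norm2_pair (z z' : net) :
  norm2 R z <= 4 * n%:R -> norm2 R z' <= 4 * n%:R ->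
  \sum_x \sum_y `|val (z x) * val (z' y)| ^+ 2 <= 16 * n%:R ^+ 2.
Proof.
move=> hz hz'; apply: (@le_trans _ _ (norm2 R z * norm2 R z')).
  rewrite le_eqVlt; apply/orP; left; apply/eqP; rewrite /norm2 mulr_suml.
  apply: eq_bigr => x _; rewrite mulr_sumr; apply: eq_bigr => y _.
  by rewrite real_normK ?num_real// exprMn.
have z0 (u : net) : 0 <= norm2 R u by rewrite sumr_ge0// => x _; exact: sqr_ge0.
have -> : 16 * n%:R ^+ 2 = 4 * n%:R * (4 * n%:R) :> R by ring.
by rewrite ler_pM.
Qed.

(** A heavy product a exceeds [t], hence a <= a^2 / t, and the squares sum to at most 16 n^2. *)
Lemma heavy_mean_bound (z z' : net) :
  norm2 R z <= 4 * n%:R -> norm2 R z' <= 4 * n%:R ->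
  \sum_x \sum_y (if `|val (z x) * val (z' y)| <= t then 0 else
     `|val (z x) * val (z' y)|) * Nt x y <= 64 * B ^+ 2 * (t * n%:R).
Proof.
move=> hz hz'; pose q := l%:R * (B ^+ 2 / n%:R ^+ 2).
have q0 : 0 <= q by rewrite mulr_ge0// divr_ge0 ?exprn_ge0.
apply: (@le_trans _ _ (\sum_x \sum_y q / t * `|val (z x) * val (z' y)| ^+ 2)).
  apply: ler_sum => x _; apply: ler_sum => y _.
  have /andP[N0 Nq] := cluster_mean_le x y.
  case: ifPn => [_|]; first by rewrite mul0r mulr_ge0 ?divr_ge0 ?exprn_ge0.
  rewrite -ltNge => lt.
  set a := `|_| in lt *; have a0 : 0 <= a by exact: normr_ge0.
  have -> : q / t * a ^+ 2 = (a * (a / t)) * q by ring.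
  rewrite ler_pM// -[leLHS]mulr1 ler_wpM2l// ler_pdivlMr// mul1r; exact: ltW.
under eq_bigr do rewrite -mulr_sumr; rewrite -mulr_sumr.
have h := sum_norm2_pair hz hz'.
apply: le_trans (ler_wpM2l (divr_ge0 q0 t_ge0) h) _.
apply: (@le_trans _ _ ((4 * t ^+ 2 * n%:R * (B ^+ 2 / n%:R ^+ 2)) / t * (16 * n%:R ^+ 2))).
  do 3 (apply: ler_wpM2r; first by rewrite ?mulr_ge0 ?invr_ge0 ?exprn_ge0).
  exact: l_le.
by rewrite le_eqVlt; apply/orP; left; apply/eqP; field; rewrite !gt_eqF.
Qed.

Variable Gamma : {set 'I_n}.
Hypothesis row_deg : forall x, x \in Gamma -> \sum_y C x y <= Delta * t ^+ 2.
Hypothesis col_deg : forall y, y \in Gamma -> \sum_x C x y <= Delta * t ^+ 2.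
Hypothesis disc : forall (i j : 'I_J) (S T : {set 'I_n}), (m < i + j)%N ->
  discrepancy l m B r (fun x y => C x y) i j S T.

Definition windowF (z z' : net) (x y : 'I_n) : R :=
  if z x is Some (_, i) then
    if z' y is Some (_, j) then if window m i j then 2 ^+ (i + j) else 0 else 0
  else 0.

Lemma sum_windowF (z z' : net) : \sum_x \sum_y windowF z z' x y * C x y =
  \sum_(i < J) \sum_(j < J | window m i j)
    2 ^+ (i + j) * edges (fun x y => C x y) (lset z i) (lset z' j).
Proof.
transitivity (\sum_(i < J) \sum_(x in lset z i) \sum_(j < J) \sum_(y in lset z' j)
    (if window m i j then 2 ^+ (i + j) else 0) * C x y); last first.
  apply: eq_bigr => i _; rewrite exchange_big [in RHS]big_mkcond; apply: eq_bigr => j _ /=.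
  rewrite /edges; case: ifP => _; last first.
    by rewrite big1// => x _; rewrite big1// => y _; rewrite mul0r.
  by rewrite mulr_sumr; apply: eq_bigr => x _; rewrite mulr_sumr.
rewrite (sum_lset z (fun i x => \sum_(j < J) \sum_(y in lset z' j)
    (if window m i j then 2 ^+ (i + j) else 0) * C x y)).
apply: eq_bigr => x _; rewrite /windowF.
case: (z x) => [[b i]|]; last by rewrite big1// => y _; rewrite mul0r.
rewrite (sum_lset z' (fun j y => (if window m i j then 2 ^+ (i + j) else 0) * C x y)).
by apply: eq_bigr => y _; case: (z' y) => [[b' j]|]; rewrite ?mul0r.
Qed.

Lemma norm_cval (b : bool) (i : 'I_J) : `|val (Some (b, i) : code J)| = 2 ^+ i.
Proof. by rewrite /= normrM normr_sign mul1r ger0_norm// exprn_ge0. Qed.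

(** When one level exceeds the other by at least [m], the product is at most the larger square
    divided by 2^m; the remaining heavy pairs are in the window. *)
Lemma heavy_pointwise (z z' : net) x y :
  (if `|val (z x) * val (z' y)| <= t then 0 else `|val (z x) * val (z' y)|) <=
  val (z x) ^+ 2 / t + val (z' y) ^+ 2 / t + windowF z z' x y.
Proof.
have sq0 (c : code J) : 0 <= val c ^+ 2 / t by rewrite divr_ge0 ?sqr_ge0.
rewrite /windowF; case ez: (z x) => [[b i]|]; last first.
  by rewrite mul0r normr0 t_ge0 addr0 addr_ge0.
case ez': (z' y) => [[b' j]|]; last first.
  by rewrite mulr0 normr0 t_ge0 addr0 addr_ge0.
have W0 : 0 <= (if window m i j then 2 ^+ (i + j) else 0 : R).
  by case: ifP => // _; rewrite exprn_ge0.
case: ifPn => [_|]; first by rewrite !addr_ge0.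
rewrite normrM !norm_cval !cval_sqr -ltNge -exprD => lt.
have mij : (m < i + j)%N by rewrite -(@ltr_eXn2l R 2) ?ltr1n.
rewrite /window mij /=.
have pw k k' : (k' + m <= k)%N -> 2 ^+ (k + k') <= (4 : R) ^+ k / t.
  move=> kk; rewrite ler_pdivlMr// -exprD.
  have -> : (4 : R) ^+ k = 2 ^+ (2 * k) by rewrite exprM; congr (_ ^+ _); ring.
  apply: ler_weXn2l; first by rewrite ler1n.
  by move: kk; clear; lia.
case: (ltnP i (j + m)) => [ij|ij]; last first.
  by rewrite /= addr0 -[leLHS]addr0 lerD// ?pw// divr_ge0 ?exprn_ge0.
case: (ltnP j (i + m)) => [ji|ji] /=; last first.
  by rewrite addr0 -[leLHS]add0r lerD// ?divr_ge0 ?exprn_ge0// addnC pw.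
by rewrite -[leLHS]add0r lerD// addr_ge0 ?divr_ge0 ?exprn_ge0.
Qed.

(** The squares divided by [t] meet the degree bound Delta t^2. Degrees are bounded only on [Gamma],
    so the vectors must vanish outside it. *)
Lemma heavy_bound (z z' : net) :
  norm2 R z <= 4 * n%:R -> norm2 R z' <= 4 * n%:R ->
  (forall x, x \notin Gamma -> z x = None) ->
  (forall x, x \notin Gamma -> z' x = None) ->
  \sum_x \sum_y (if `|val (z x) * val (z' y)| <= t then 0 else
     `|val (z x) * val (z' y)|) * C x y <=
  (8 * Delta + (128 * B ^+ 2 + 48 * (33 + 16 * r))) * (t * n%:R).
Proof.
move=> hz hz' zG z'G.
apply: (@le_trans _ _ (\sum_x val (z x) ^+ 2 / t * \sum_y C x y +
   \sum_y val (z' y) ^+ 2 / t * \sum_x C x y + \sum_x \sum_y windowF z z' x y * C x y)).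
  have -> : \sum_y val (z' y) ^+ 2 / t * \sum_x C x y =
     \sum_x \sum_y val (z' y) ^+ 2 / t * C x y.
    by rewrite exchange_big; apply: eq_bigr => y _; rewrite mulr_sumr.
  rewrite -!big_split; apply: ler_sum => x _ /=.
  rewrite mulr_sumr -!big_split; apply: ler_sum => y _ /=.
  by rewrite -!(mulrDl _ _ (C x y)) ler_wpM2r// heavy_pointwise.
rewrite sum_windowF.
have W := sum_window n0 hl hJ B1 r0 hz hz' disc.
have part (u : net) (D : 'I_n -> R) : norm2 R u <= 4 * n%:R ->
    (forall x, x \notin Gamma -> u x = None) ->
    (forall x, x \in Gamma -> D x <= Delta * t ^+ 2) ->
    \sum_x val (u x) ^+ 2 / t * D x <= 4 * Delta * (t * n%:R).
  move=> hu uG DG; apply: (@le_trans _ _ (\sum_x Delta * t * val (u x) ^+ 2)).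
    apply: ler_sum => x _; have [xG|xG] := boolP (x \in Gamma); last first.
      by rewrite uG// expr0n /= mul0r mul0r mulr0.
    have -> : Delta * t * val (u x) ^+ 2 = val (u x) ^+ 2 / t * (Delta * t ^+ 2).
      by field; rewrite gt_eqF.
    by rewrite ler_wpM2l ?DG// divr_ge0 ?sqr_ge0.
  rewrite -mulr_sumr; apply: le_trans (ler_wpM2l _ hu) _; first by rewrite mulr_ge0.
  by rewrite le_eqVlt; apply/orP; left; apply/eqP; ring.
have P1 := part z _ hz zG row_deg; have P2 := part z' _ hz' z'G col_deg.
apply: le_trans (lerD (lerD P1 P2) W) _.
by rewrite le_eqVlt; apply/orP; left; apply/eqP; ring.
Qed.

Hypothesis light : forall z z' : net, norm2 R z <= 4 * n%:R -> norm2 R z' <= 4 * n%:R ->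
  \sum_x \sum_y lightF R m z z' x y * (C x y - Nt x y) <= L * (t * n%:R).

Lemma centered_bound (z z' : net) :
  norm2 R z <= 4 * n%:R -> norm2 R z' <= 4 * n%:R ->
  (forall x, x \notin Gamma -> z x = None) ->
  (forall x, x \notin Gamma -> z' x = None) ->
  \sum_x \sum_y val (z x) * val (z' y) * (C x y - Nt x y) <=
  (L + 8 * Delta + 192 * B ^+ 2 + 48 * (33 + 16 * r)) * (t * n%:R).
Proof.
move=> hz hz' zG z'G.
apply: (@le_trans _ _ (\sum_x \sum_y lightF R m z z' x y * (C x y - Nt x y) +
  (\sum_x \sum_y (if `|val (z x) * val (z' y)| <= t then 0 else
     `|val (z x) * val (z' y)|) * C x y +
  \sum_x \sum_y (if `|val (z x) * val (z' y)| <= t then 0 else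
     `|val (z x) * val (z' y)|) * Nt x y))).
  rewrite -!big_split; apply: ler_sum => x _ /=.
  rewrite -!big_split; apply: ler_sum => y _ /=.
  have /andP[N0 _] := cluster_mean_le x y; rewrite /lightF.
  case: ifP => _; first by rewrite !mul0r !addr0.
  rewrite mul0r add0r -mulrDr; set a := _ * val _.
  apply: le_trans (ler_norm _) _; rewrite normrM ler_wpM2l//.
  by apply: le_trans (ler_normB _ _) _; rewrite !ger0_norm.
apply: le_trans (lerD (light hz hz') (lerD (heavy_bound hz hz' zG z'G) (heavy_mean_bound hz hz'))) _.
by rewrite le_eqVlt; apply/orP; left; apply/eqP; ring.
Qed.

Variable N : 'M[R]_n.
Hypothesis N_le : forall x y, 0 <= N x y <= l%:R * (B ^+ 2 / n%:R ^+ 2).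
Hypothesis dev : forall x y, `|Nt x y - N x y| <= H * t * n%:R * (B ^+ 2 / n%:R ^+ 2).
Hypothesis card_Gamma : #|~: Gamma|%:R <= n%:R * expR (- (l%:R / n%:R)) :> R.

Lemma sum_abs_pair (z z' : net) :
  norm2 R z <= 4 * n%:R -> norm2 R z' <= 4 * n%:R ->
  \sum_x \sum_y `|val (z x)| * `|val (z' y)| <= 4 * n%:R ^+ 2.
Proof.
move=> hz hz'.
apply: (@le_trans _ _ (\sum_(x < n) \sum_(y < n) (val (z x) ^+ 2 / 2 + val (z' y) ^+ 2 / 2))).
  apply: ler_sum => x _; apply: ler_sum => y _.
  rewrite -[val (z x) ^+ 2]real_normK ?num_real// -[val (z' y) ^+ 2]real_normK ?num_real//.
  by have := sqr_ge0 (`|val (z x)| - `|val (z' y)|); nra.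
have -> : \sum_(x < n) \sum_(y < n) (val (z x) ^+ 2 / 2 + val (z' y) ^+ 2 / 2) =
    (norm2 R z + norm2 R z') * n%:R / 2.
  under eq_bigr do rewrite big_split /= sumr_const card_ord.
  by rewrite big_split /= sumr_const card_ord sumrMnl -!mulr_suml -[_ *+ n]mulr_natr -[X in _ + X]mulr_natr /norm2; field.
move: hz hz'; rewrite /norm2; set a := \sum_x _; set b := \sum_x _ => hz hz'.
have : a * n%:R <= 4 * n%:R * n%:R by rewrite ler_wpM2r.
have : b * n%:R <= 4 * n%:R * n%:R by rewrite ler_wpM2r.
by rewrite expr2; lra.
Qed.

Lemma deviation_bound (z z' : net) :
  norm2 R z <= 4 * n%:R -> norm2 R z' <= 4 * n%:R ->
  \sum_x \sum_y val (z x) * val (z' y) * (Nt x y - N x y) <=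
  4 * B ^+ 2 * H * (t * n%:R).
Proof.
move=> hz hz'; pose q := H * t * n%:R * (B ^+ 2 / n%:R ^+ 2).
have q0 : 0 <= q by rewrite !mulr_ge0 ?invr_ge0 ?exprn_ge0.
apply: (@le_trans _ _ (\sum_x \sum_y q * (`|val (z x)| * `|val (z' y)|))).
  apply: ler_sum => x _; apply: ler_sum => y _.
  apply: le_trans (ler_norm _) _; rewrite !normrM mulrC.
  by rewrite ler_wpM2r ?mulr_ge0//; exact: dev.
under eq_bigr do rewrite -mulr_sumr; rewrite -mulr_sumr.
apply: le_trans (ler_wpM2l q0 (sum_abs_pair hz hz')) _; rewrite /q.
by rewrite le_eqVlt; apply/orP; left; apply/eqP; field; rewrite gt_eqF.
Qed.

(** Restricting the matrix to [Gamma] amounts to erasing the other coordinates of both vectors, and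
    the result is again in the net. *)
Definition trim (z : net) : net := [ffun x => if x \in Gamma then z x else None].

Lemma trimE z x : val (trim z x) = (x \in Gamma)%:R * val (z x).
Proof. by rewrite ffunE; case: ifP => _; rewrite ?mul1r ?mul0r. Qed.

Lemma norm2_trim z : norm2 R (trim z) <= norm2 R z.
Proof.
apply: ler_sum => x _; rewrite trimE; case: (x \in _); rewrite ?mul1r// mul0r expr0n.
exact: sqr_ge0.
Qed.

(** At most n tau^2 states are removed, with tau = exp (- l / (2 n)). Weighting the inequality of
    the means by tau bounds the lost part of [N] by 8 B^2 l tau, and l tau <= 2 n because exp x >=
    x. The size of the complement of [Gamma] enters here. *)
Lemma trimmed_mean_bound (z z' : net) :
  norm2 R z <= 4 * n%:R -> norm2 R z' <= 4 * n%:R ->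
  \sum_x \sum_y (val (trim z x) * val (trim z' y) - val (z x) * val (z' y)) * N x y <=
  16 * B ^+ 2 * (t * n%:R).
Proof.
move=> hz hz'; pose tau : R := expR (- (l%:R / n%:R / 2)).
have tau0 : 0 < tau by exact: expR_gt0.
have tau1 := ltW tau0.
have tau2 : expR (- (l%:R / n%:R)) = tau ^+ 2.
  by rewrite -expRM_natl; congr expR; field; rewrite gt_eqF.
have ltau : l%:R * tau <= 2 * n%:R.
  have := expR_ge1Dx (l%:R / n%:R / 2 : R).
  have e : expR (l%:R / n%:R / 2) * tau = 1 by rewrite -expRD subrr expR0.
  set E := expR _ in e * => h.
  have E0 : 0 < E by exact: expR_gt0.
  have : l%:R <= 2 * n%:R * E.
    have : 2 * n%:R * (l%:R / n%:R / 2) <= 2 * n%:R * E by rewrite ler_wpM2l ?mulr_ge0//; lra.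
    by apply: le_trans; rewrite le_eqVlt; apply/orP; left; apply/eqP; field; rewrite gt_eqF.
  by move=> /(ler_wpM2r tau1) h2; rewrite -[_ * E * tau]mulrA e mulr1 in h2.
pose q := l%:R * (B ^+ 2 / n%:R ^+ 2).
have q0 : 0 <= q by rewrite !mulr_ge0 ?invr_ge0 ?exprn_ge0.
pose G x : R := (x \notin Gamma)%:R.
have G01 x : G x = 0 \/ G x = 1 by rewrite /G; case: (_ \notin _); [right|left].
have sG : \sum_x G x <= n%:R * tau ^+ 2.
  rewrite -tau2; apply: le_trans card_Gamma; rewrite /G -natr_sum.
  by rewrite ler_nat -sum1_card [leqRHS]big_mkcond; apply: leq_sum => x _; rewrite inE; case: (_ \in _).
apply: (@le_trans _ _ (\sum_x \sum_y q * ((tau / 2 * val (z x) ^+ 2 + (2 * tau)^-1 * (G x * val (z' y) ^+ 2)) +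
   (tau / 2 * val (z' y) ^+ 2 + (2 * tau)^-1 * (G y * val (z x) ^+ 2))))).
  apply: ler_sum => x _; apply: ler_sum => y _.
  have /andP[N0 Nq] := N_le x y.
  apply: le_trans (ler_norm _) _; rewrite normrM (ger0_norm N0) mulrC.
  rewrite ler_pM// !trimE.
  have -> : (x \in Gamma)%:R = 1 - G x by rewrite /G; case: (x \in Gamma); rewrite /= ?subr0 ?subrr.
  have -> : (y \in Gamma)%:R = 1 - G y by rewrite /G; case: (y \in Gamma); rewrite /= ?subr0 ?subrr.
  set a := val (z x); set b := val (z' y).
  have amgm u w : `|u * w| <= tau / 2 * u ^+ 2 + (2 * tau)^-1 * w ^+ 2.
    rewrite normrM -[u ^+ 2]real_normK ?num_real// -[w ^+ 2]real_normK ?num_real//.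
    have -> : tau / 2 * `|u| ^+ 2 + (2 * tau)^-1 * `|w| ^+ 2 =
       `|u| * `|w| + (2 * tau)^-1 * (tau * `|u| - `|w|) ^+ 2 by field; rewrite gt_eqF.
    by rewrite lerDl mulr_ge0 ?sqr_ge0// invr_ge0 mulr_ge0.
  have e : 0 <= tau / 2 * a ^+ 2 by rewrite mulr_ge0 ?sqr_ge0 ?divr_ge0.
  have e' : 0 <= tau / 2 * b ^+ 2 by rewrite mulr_ge0 ?sqr_ge0 ?divr_ge0.
  have d : 0 <= (2 * tau)^-1 * a ^+ 2 by rewrite mulr_ge0 ?sqr_ge0 ?invr_ge0 ?mulr_ge0.
  have d' : 0 <= (2 * tau)^-1 * b ^+ 2 by rewrite mulr_ge0 ?sqr_ge0 ?invr_ge0 ?mulr_ge0.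
  case: (G01 x) => ->; case: (G01 y) => ->; rewrite ?subr0 ?subrr ?mul1r ?mul0r ?mulr0 ?sub0r ?addr0 ?subrr ?normr0 ?normrN.
  - by lra.
  - by have := amgm b a; rewrite mulrC; lra.
  - by have := amgm a b; lra.
  - by have := amgm a b; lra.
under eq_bigr do rewrite -mulr_sumr; rewrite -mulr_sumr.
have s1 (u : net) : norm2 R u <= 4 * n%:R -> \sum_(x < n) \sum_(y < n) tau / 2 * val (u x) ^+ 2 <= 2 * tau * n%:R ^+ 2.
  move=> hu; under eq_bigr do rewrite sumr_const card_ord.
  rewrite sumrMnl -mulr_sumr -/(norm2 R u) -[_ *+ n]mulr_natr.
  apply: (@le_trans _ _ (tau / 2 * (4 * n%:R) * n%:R)).
    by apply: ler_wpM2r => //; apply: ler_wpM2l => //; rewrite divr_ge0.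
  by rewrite le_eqVlt; apply/orP; left; apply/eqP; field.
have s2 (u : net) : norm2 R u <= 4 * n%:R ->
   \sum_(x < n) \sum_(y < n) (2 * tau)^-1 * (G x * val (u y) ^+ 2) <= 2 * tau * n%:R ^+ 2.
  move=> hu; under eq_bigr do rewrite -mulr_sumr -mulr_sumr.
  rewrite -mulr_sumr -mulr_suml -/(norm2 R u).
  apply: (@le_trans _ _ ((2 * tau)^-1 * ((n%:R * tau ^+ 2) * (4 * n%:R)))).
    apply: ler_wpM2l; first by rewrite invr_ge0 mulr_ge0.
    apply: ler_pM => //; first by rewrite sumr_ge0.
    by rewrite sumr_ge0// => x _; exact: sqr_ge0.
  by rewrite le_eqVlt; apply/orP; left; apply/eqP; field; rewrite gt_eqF.
have tot : \sum_x \sum_y ((tau / 2 * val (z x) ^+ 2 + (2 * tau)^-1 * (G x * val (z' y) ^+ 2)) +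
   (tau / 2 * val (z' y) ^+ 2 + (2 * tau)^-1 * (G y * val (z x) ^+ 2))) <= 8 * tau * n%:R ^+ 2.
  under eq_bigr do rewrite !big_split; rewrite !big_split /=.
  have h1 := s1 z hz; have h2 := s2 z' hz'; have h3 := s1 z' hz'; have h4 := s2 z hz.
  rewrite exchange_big in h3; rewrite exchange_big in h4.
  apply: le_trans (lerD (lerD h1 h2) (lerD h3 h4)) _.
  by rewrite le_eqVlt; apply/orP; left; apply/eqP; ring.
apply: le_trans (ler_wpM2l q0 tot) _.
have -> : q * (8 * tau * n%:R ^+ 2) = 8 * B ^+ 2 * (l%:R * tau) by rewrite /q; field; rewrite gt_eqF.
apply: (@le_trans _ _ (8 * B ^+ 2 * (2 * n%:R))); first by rewrite ler_wpM2l// mulr_ge0 ?sqr_ge0.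
have -> : 8 * B ^+ 2 * (2 * n%:R) = 16 * B ^+ 2 * (1 * n%:R) by ring.
by rewrite ler_wpM2l ?mulr_ge0 ?sqr_ge0// ler_wpM2r.
Qed.

Lemma sigma1_trimmed_le : sigma1 (restrict_mx Gamma C - N) <=
  4 * (L + 8 * Delta + 208 * B ^+ 2 + 48 * (33 + 16 * r) + 4 * B ^+ 2 * H) * t.
Proof.
set c := (X in 4 * X * _).
have c0 : 0 < c.
  have : 0 <= B ^+ 2 * H by rewrite mulr_ge0 ?sqr_ge0.
  by rewrite /c; have := sqr_ge0 B; move: L0 Delta0 r0; lra.
have [nJ _] := andP hJ.
have -> : 4 * c * t = 4 * (c * (t * n%:R)) / n%:R by field; rewrite gt_eqF.
apply: (@sigma1_le_net _ J) => //; first by rewrite !mulr_gt0.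
move=> z z' hz hz'.
have hzt : norm2 R (trim z) <= 4 * n%:R by exact: le_trans (norm2_trim z) hz.
have hzt' : norm2 R (trim z') <= 4 * n%:R by exact: le_trans (norm2_trim z') hz'.
have tG (u : net) x : x \notin Gamma -> trim u x = None by rewrite ffunE => /negbTE ->.
have h1 := centered_bound hzt hzt' (tG z) (tG z').
have h2 := deviation_bound hzt hzt'; have h3 := trimmed_mean_bound hz hz'.
(* Three parts: fluctuation around the conditional mean, fluctuation of the conditional mean, and
   the part of [N] lost by trimming. *)
have -> : \sum_x \sum_y (restrict_mx Gamma C - N) x y * (val (z x) * val (z' y)) =
  \sum_x \sum_y val (trim z x) * val (trim z' y) * (C x y - Nt x y) +
  \sum_x \sum_y val (trim z x) * val (trim z' y) * (Nt x y - N x y) +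
  \sum_x \sum_y (val (trim z x) * val (trim z' y) - val (z x) * val (z' y)) * N x y.
  rewrite -!big_split; apply: eq_bigr => x _ /=; rewrite -!big_split; apply: eq_bigr => y _ /=.
  rewrite !mxE !trimE; case: (x \in Gamma); case: (y \in Gamma); rewrite /= ?mulr1n ?mulr0n; ring.
apply: le_trans (lerD (lerD h1 h2) h3) _.
by rewrite le_eqVlt; apply/orP; left; apply/eqP; rewrite /c; ring.
Qed.

End TrimmedBound.

(** * Exponential moments and union bounds *)

Section ExponentialBounds.
Variable R : realType.

(** Multiply by exp (- x) >= 1 - x: the product (1 - x) (1 + x + 2 x^2) is at least 1 for x <=
    1/2. *)
Lemma expR_le_quadratic (x : R) : x <= 2^-1 -> expR x <= 1 + x + 2 * x ^+ 2.
Proof.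
move=> x2; have h := expR_ge1Dx (- x).
have e : expR (- x) * expR x = 1 by rewrite -expRD addNr expR0.
have e0 := expR_gt0 x; have x0 := sqr_ge0 x.
have k : (1 - x) * (1 + x + 2 * x ^+ 2) = 1 + x ^+ 2 * (1 - 2 * x) by ring.
have q0 : 0 <= 1 + x + 2 * x ^+ 2 by have := sqr_ge0 (x + 4^-1); lra.
have : 1 <= expR (- x) * (1 + x + 2 * x ^+ 2).
  apply: (@le_trans _ _ ((1 - x) * (1 + x + 2 * x ^+ 2))); last by rewrite ler_wpM2r.
  by rewrite k lerDl mulr_ge0//; lra.
move=> /(ler_wpM2l (ltW e0)); rewrite mulr1 mulrA [expR x * _]mulrC e mul1r.
by [].
Qed.

Lemma expRN_nat_le (k : nat) : expR (- k%:R) <= 2 ^- k :> R.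
Proof.
rewrite expRN lef_pV2 ?posrE ?expR_gt0 ?exprn_gt0// -[k%:R]mulr1 expRM_natl.
by rewrite lerXn2r ?nnegrE ?expR_ge0//; have := expR_ge1Dx (1 : R); lra.
Qed.

(** The Chernoff parameter k / 4 of the discrepancy, doubled by the splitting into even and odd
    pairs; it suffices that exp (1/2) <= 2. *)
Lemma expR_half_nat_le (k : nat) : expR (2 * (k%:R / 4)) <= 2 ^+ k :> R.
Proof.
have -> : 2 * (k%:R / 4) = k%:R * 2^-1 :> R by field.
rewrite expRM_natl lerXn2r ?nnegrE ?expR_ge0//.
have := @expR_le_quadratic 2^-1 (lexx _).
have -> : 1 + 2^-1 + 2 * 2^-1 ^+ 2 = 2 :> R by field.
by [].
Qed.

Lemma sum_exp2N (J : nat) : \sum_(i < J) 2 ^- i.+1 <= 1 :> R.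
Proof.
suff : \sum_(i < J) 2 ^- i.+1 <= 1 - 2 ^- J :> R.
  by move/le_trans; apply; rewrite gerBl invr_ge0 exprn_ge0.
elim: J => [|J IH]; first by rewrite big_ord0 expr0 invr1 subrr.
rewrite big_ord_recr /=; apply: le_trans (lerD IH (lexx _)) _.
by rewrite exprS invfM; set q := (2 ^+ J)^-1; lra.
Qed.

Lemma sum_expR_code J : \sum_(c : code J) expR (- (cval R c ^+ 2 + 2)) <= 1.
Proof.
have e2 : expR (- 2) <= 4^-1 :> R.
  by have := expRN_nat_le 2; rewrite (_ : 2 ^- 2 = 4^-1 :> R)//; congr (_^-1); ring.
have level (i : nat) : expR (- 4 ^+ i) <= 2 ^- i.+1 :> R.
  rewrite expRN lef_pV2 ?posrE ?expR_gt0 ?exprn_gt0//.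
  apply: le_trans (expR_ge1Dx _); rewrite exprS.
  have -> : 4 ^+ i = (2 ^+ i) ^+ 2 :> R by rewrite exprAC; congr (_ ^+ _); ring.
  by have := sqr_ge0 (2 ^+ i - 1 : R); rewrite sqrrB1; lra.
rewrite (eq_bigr (fun c : code J => expR (- 2) * expR (- cval R c ^+ 2))); last first.
  by move=> c _; rewrite -expRD opprD addrC.
rewrite -mulr_sumr; set s := \sum_c _.
suff : s <= 3.
  move=> s3; have : expR (- 2) * s <= 4^-1 * 3 by rewrite ler_pM ?expR_ge0 ?sumr_ge0// => *; exact: expR_ge0.
  by lra.
rewrite /s (bigD1 None)//= expr0n oppr0 expR0.
rewrite (eq_bigr (fun c : code J => if c is Some (_, i) then expR (- 4 ^+ i) else 0)); last first.
  by move=> [[b i]|//] _; rewrite cval_sqr.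
rewrite (reindex_omap Some id) /=; last by case.
rewrite (eq_bigl xpredT); last by move=> p; rewrite eqxx.
rewrite (eq_bigr (fun p : bool * 'I_J => expR (- 4 ^+ p.2))); last by case.
rewrite -(pair_bigA _ (fun (b : bool) (i : 'I_J) => expR (- 4 ^+ i))) /=.
rewrite big_bool; have : \sum_(i < J) expR (- 4 ^+ i) <= 1 :> R.
  by apply: le_trans (sum_exp2N J); apply: ler_sum => i _; exact: level.
move=> H; rewrite /=; lra.
Qed.

(** Replaces a count of the net: with these weights the total is at most 1 whatever [J], and a
    vector of square norm at most 4 n costs at most 6 n in a union bound. *)
Lemma sum_expR_net (J n : nat) :
  \sum_(z : {ffun 'I_n -> code J}) expR (- (norm2 R z + 2 * n%:R)) <= 1.
Proof.
rewrite (eq_bigr (fun z : {ffun 'I_n -> code J} => \prod_x expR (- (cval R (z x) ^+ 2 + 2)))); last first.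
  move=> z _; rewrite -expR_sum sumrN big_split /= sumr_const card_ord.
  by rewrite mulr_natr.
rewrite -(bigA_distr_bigA (fun _ c => expR (- (cval R c ^+ 2 + 2)))) /=.
apply: prodr_ile1 => i _; rewrite sum_expR_code sumr_ge0// => c _; exact: expR_ge0.
Qed.

Lemma sum_expR_set (n : nat) (c : R) :
  \sum_(S : {set 'I_n}) expR (- (c * #|S|%:R)) <= expR (n%:R * expR (- c)).
Proof.
have -> : \sum_(S : {set 'I_n}) expR (- (c * #|S|%:R)) = \prod_(x < n) (expR (- c) + 1).
  rewrite bigA_distr /=; apply: eq_bigr => S _.
  rewrite -big_mkcond /= prodr_const -mulNr mulrC expRM_natl.
  by [].
rewrite prodr_const card_ord expRM_natl lerXn2r ?nnegrE ?addr_ge0 ?expR_ge0//.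
by rewrite addrC expR_ge1Dx.
Qed.

(** Summing over the sets gives at most exp (n exp (-4 (i + 1))), which the term n / 16^(i+1) of the
    cost compensates since exp (-4) <= 1/16. What is left, exp (- (i + 1) - r), is summable over the
    levels. *)
Lemma sum_level_cost_expR (n J : nat) (r : R) :
  \sum_(i < J) \sum_(S : {set 'I_n}) expR (- level_cost n r i #|S|) <= expR (- r).
Proof.
apply: (@le_trans _ _ (\sum_(i < J) expR (- r) * 2 ^- i.+1)); last first.
  by rewrite -mulr_sumr -[leRHS]mulr1 ler_wpM2l ?expR_ge0// sum_exp2N.
apply: ler_sum => i _.
rewrite (eq_bigr (fun S : {set 'I_n} => expR (- (n%:R / 16 ^+ i.+1 + (i.+1%:R + r))) *
    expR (- (4 * i.+1%:R * #|S|%:R)))); last first.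
  by move=> S _; rewrite -expRD /level_cost; congr expR; ring.
rewrite -mulr_sumr; apply: le_trans (ler_wpM2l (expR_ge0 _) (sum_expR_set _ _)) _.
rewrite -expRD; apply: (@le_trans _ _ (expR (- r - i.+1%:R))).
  rewrite ler_expR.
  have : n%:R * expR (- (4 * i.+1%:R)) <= n%:R * (16 ^+ i.+1)^-1 :> R.
    rewrite ler_wpM2l// -natrM; apply: le_trans (expRN_nat_le _) _.
    by rewrite exprM (_ : 2 ^+ 4 = 16 :> R)//; ring.
  by lra.
by rewrite expRD ler_wpM2l ?expR_ge0// expRN_nat_le.
Qed.

End ExponentialBounds.

Section CountMatrix.
Variables (R : realType) (n : nat).

Definition path_counts (x : 'I_n) (s : seq 'I_n) : 'M[R]_n :=
  \matrix_(a, b) psum (fun u w => ((u == a) && (w == b))%:R) x s.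

Lemma path_counts_ge0 x s a b : 0 <= path_counts x s a b.
Proof. by rewrite mxE psum_ge0. Qed.

(** Every linear functional of the count matrix is a path sum, to which the exponential moment bound
    applies. *)
Lemma sum_path_counts (f : 'I_n -> 'I_n -> R) x s :
  \sum_a \sum_b f a b * path_counts x s a b = psum f x s.
Proof.
under eq_bigr do under eq_bigr do rewrite mxE -psumZ.
under eq_bigr do rewrite -psum_sum; rewrite -psum_sum.
apply: eq_psum => u w.
rewrite (bigD1 u)//= (bigD1 w)//= !eqxx mulr1 big1 => [|b /negbTE bw]; last first.
  by rewrite eq_sym bw mulr0.
rewrite addr0 big1 ?addr0// => a /negbTE au; rewrite big1// => b _.
by rewrite eq_sym au mulr0.
Qed.

Lemma path_counts_total x s : \sum_a \sum_b path_counts x s a b = (size s)%:R.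
Proof.
rewrite -(psum_cst (1 : R) x s) -sum_path_counts.
by apply: eq_bigr => a _; apply: eq_bigr => b _; rewrite mul1r.
Qed.

Lemma path_counts_traj (X : nat -> 'I_n) l :
  path_counts (X 0%N) [seq X i | i <- iota 1 l] = count_mx R l X.
Proof.
apply/matrixP => a b; rewrite !mxE.
suff H k : psum (fun u w => ((u == a) && (w == b))%:R : R) (X k) [seq X i | i <- iota k.+1 l] =
    \sum_(t < l) ((X (k + t)%N == a) && (X (k + t).+1 == b))%:R.
  exact: H.
elim: l k => [|l IH] k /=; first by rewrite big_ord0.
rewrite big_ord_recl /= addn0 IH; congr (_ + _); apply: eq_bigr => t _.
by rewrite /bump /= addnA addn1.
Qed.

End CountMatrix.

(** * Failure events along the path *)

Section Events.
Variables (R : realType) (K n : nat) (sigma : 'I_n -> 'I_K).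
Variables (p : 'M[R]_K) (pi : 'rV[R]_K) (B : R).
Hypothesis hp : stochastic p.
Hypothesis pi0 : forall k, 0 <= pi 0 k.
Hypothesis pi1 : \sum_k pi 0 k = 1.
Hypothesis n0 : (0 < n)%N.
Hypothesis B1 : 1 <= B.
Hypothesis hB : forall k, n%:R <= B * #|bmc_cluster sigma k|%:R.

Local Notation v k := (#|bmc_cluster sigma k|%:R : R).
Local Notation P := (fun x y => bmc_transition sigma p x y).
Local Notation mu := (fun x => bmc_stationary sigma pi 0 x).
Local Notation E := (chainE P mu).
Local Notation cnt x s := (fun a b => path_counts R x s a b).

Let nR : 0 < n%:R :> R. Proof. by rewrite ltr0n. Qed.
Let nR0 : 0 <= n%:R :> R. Proof. exact: ltW. Qed.
Let B0 : 0 <= B. Proof. exact: le_trans B1. Qed.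
Let v0 k : 0 < v k.
Proof.
have := lt_le_trans nR (hB k); rewrite pmulr_rgt0//; exact: lt_le_trans B1.
Qed.
Let hsurj k : (0 < #|bmc_cluster sigma k|)%N.
Proof. by have := v0 k; rewrite ltr0n. Qed.

(** Markov's inequality for the exponential of each path sum, whose expectation is at most 1,
    followed by a union bound. Each [g j] includes the compensator that makes its exponential moment
    at most 1. *)
Lemma chainE_exp_union (I : finType) (ok : pred I) (t : nat)
    (bad : I -> 'I_n -> seq 'I_n -> bool) (g : I -> 'I_n -> 'I_n -> R) (c : I -> R)
    (delta : R) :
  (forall j, ok j -> forall a b,
     \sum_(x | sigma x == a) \sum_(y | sigma y == b) expR (2 * g j x y) <= v a * v b) ->
  (forall j x s, ok j -> size s = t -> bad j x s -> c j <= psum (g j) x s) ->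
  \sum_(j | ok j) expR (- c j) <= delta ->
  E t (fun x s => [exists j, ok j && bad j x s]%:R) <= delta.
Proof.
move=> hg hbad hc; apply: le_trans hc.
apply: (@le_trans _ _ (E t (fun x s => \sum_(j | ok j) expR (- c j) * expR (psum (g j) x s)))).
  apply: le_chainE => [x y|x|x s st]; [exact: bmc_transition_ge0|exact: bmc_stationary_ge0|].
  have pos j : 0 <= expR (- c j) * expR (psum (g j) x s) by rewrite mulr_ge0 ?expR_ge0.
  case: existsP => [[j /andP[okj bj]]|_] /=; last by rewrite sumr_ge0.
  rewrite (bigD1 j)//= -expRD -[leLHS]addr0 lerD ?sumr_ge0//.
  rewrite -expR0 ler_expR; have := hbad j x s okj st bj; lra.
rewrite chainE_sum; apply: ler_sum => j okj; rewrite chainEZ -[leRHS]mulr1.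
by rewrite ler_wpM2l ?expR_ge0//; exact: (chainE_expR_psum hp pi0 pi1 hsurj t (hg j okj)).
Qed.

Lemma block_sum_const (c : R) a b :
  \sum_(x | sigma x == a) \sum_(y | sigma y == b) c = v a * v b * c.
Proof.
rewrite (eq_bigr (fun=> v b * c)) => [|x _]; last first.
  by rewrite -(sum_cluster1 R sigma b) mulr_suml; under [RHS]eq_bigr do rewrite mul1r.
rewrite -(sum_cluster1 R sigma a) -mulrA mulr_suml.
by under [RHS]eq_bigr do rewrite mul1r.
Qed.

Lemma block_sum_le (f : 'I_n -> 'I_n -> R) a b : (forall x y, 0 <= f x y) ->
  \sum_(x | sigma x == a) \sum_(y | sigma y == b) f x y <= \sum_x \sum_y f x y.
Proof.
move=> f0; rewrite big_mkcond; apply: ler_sum => x _.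
case: ifP => _; last by rewrite sumr_ge0.
by rewrite big_mkcond; apply: ler_sum => y _; case: ifP.
Qed.

Lemma le_block_avg a b (q w : R) : 0 <= q -> q <= w -> q <= v a * v b * (B ^+ 2 / n%:R ^+ 2 * w).
Proof.
move=> q0 qw; rewrite mulrA -[leLHS]mul1r ler_pM//.
have := inv_cluster_le n0 B1 hB a b.
by rewrite -[leLHS]mul1r ler_pdivrMr ?mulr_gt0// mulrC.
Qed.

(** Pairing with the conditional mean is also a path sum, for the block averages of [F]; centred
    sums can thus be treated as a single path sum. *)
Lemma sum_cluster_mean (F : 'I_n -> 'I_n -> R) x s :
  \sum_a \sum_b F a b * cluster_mean sigma (cnt x s) a b =
  psum (fun u w => (\sum_(a | sigma a == sigma u) \sum_(b | sigma b == sigma w) F a b) /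
    (v (sigma u) * v (sigma w))) x s.
Proof.
rewrite -sum_path_counts.
pose Fb i j := \sum_(a | sigma a == i) \sum_(b | sigma b == j) F a b.
have blk (G : 'I_n -> 'I_n -> R) : \sum_a \sum_b G a b =
    \sum_i \sum_j \sum_(a | sigma a == i) \sum_(b | sigma b == j) G a b.
  rewrite (partition_big sigma xpredT)//=; apply: eq_bigr => i _.
  rewrite exchange_big (partition_big sigma xpredT)//=; apply: eq_bigr => j _.
  by rewrite exchange_big.
rewrite blk [RHS]blk; apply: eq_bigr => i _; apply: eq_bigr => j _.
transitivity (Fb i j * (cluster_count sigma (cnt x s) i j / (v i * v j))).
  rewrite /Fb mulr_suml; apply: eq_bigr => a /eqP ai; rewrite mulr_suml.
  by apply: eq_bigr => b /eqP bj; rewrite /cluster_mean ai bj.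
rewrite mulrCA /cluster_count mulr_suml; apply: eq_bigr => a /eqP ai; rewrite mulr_suml.
by apply: eq_bigr => b /eqP bj; rewrite ai bj mulrC.
Qed.

Lemma cluster_countE x s i j : cluster_count sigma (cnt x s) i j =
  psum (fun u w => ((sigma u == i) && (sigma w == j))%:R) x s.
Proof.
rewrite -sum_path_counts /cluster_count big_mkcond; apply: eq_bigr => a _ /=.
case: (sigma a == i) => /=; last by rewrite big1// => b _; rewrite mul0r.
rewrite big_mkcond; apply: eq_bigr => b _ /=.
by case: (sigma b == j); rewrite ?mul1r ?mul0r.
Qed.

Variables (l m J : nat) (r : R).
Hypothesis hl : (4 ^ m * n <= l < 4 ^ m.+1 * n)%N.
Hypothesis r0 : 0 <= r.
Local Notation t := (2 ^+ m : R).
Local Notation net := {ffun 'I_n -> code J}.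
Let t_gt0 : 0 < t. Proof. by rewrite exprn_gt0. Qed.
Let t_ge0 : 0 <= t. Proof. exact: ltW. Qed.
Let l_le : l%:R <= 4 * t ^+ 2 * n%:R :> R.
Proof.
have [_ /ltnW] := andP hl; rewrite -(ler_nat R) natrM expnS natrM.
by rewrite sqr_exp2.
Qed.
Let n1 : 1 <= n%:R :> R. Proof. by rewrite ler1n. Qed.

(* The exponent 16 B^2 n of the variance, 12 n for the two nets and r n for the
   probability, multiplied by 4 because the Chernoff parameter is 1 / (4 * 2^m). *)
Definition light_const : R := 64 * B ^+ 2 + 48 + 4 * r.

Definition light_net (zz : net * net) : bool :=
  (norm2 R zz.1 <= 4 * n%:R) && (norm2 R zz.2 <= 4 * n%:R).

Definition light_fail (zz : net * net) (x : 'I_n) (s : seq 'I_n) : bool :=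
  ~~ (\sum_a \sum_b lightF R m zz.1 zz.2 a b *
     (path_counts R x s a b - cluster_mean sigma (cnt x s) a b) <=
     light_const * (t * n%:R)).

(** Bernstein's argument for each pair of net vectors: subtracting the block average [mF] removes
    the linear term, and the product of the norms controls the quadratic one. *)
Lemma light_event : E l (fun x s =>
  [exists zz : net * net, light_net zz && light_fail zz x s]%:R) <= expR (- r).
Proof.
(* Light products are at most [t], so [2 * th * F] is at most 1/2, as the quadratic bound
   requires. *)
pose th : R := (4 * t)^-1.
pose F (zz : net * net) := lightF R m zz.1 zz.2.
pose mF (zz : net * net) u w := (\sum_(a | sigma a == u) \sum_(b | sigma b == w) F zz a b) / (v u * v w).
pose ka : R := 64 * th ^+ 2 * B ^+ 2.
pose g (zz : net * net) x y := th * (F zz x y - mF zz (sigma x) (sigma y)) - ka.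
pose c (zz : net * net) : R := (norm2 R zz.1 + 2 * n%:R) + (norm2 R zz.2 + 2 * n%:R) + r.
have th0 : 0 <= th by rewrite invr_ge0 mulr_ge0.
have F_le zz x y : `|F zz x y| <= t by rewrite /F /lightF; case: ifP => // _; rewrite normr0.
have F_sqr zz a b : light_net zz ->
    \sum_(x | sigma x == a) \sum_(y | sigma y == b) F zz x y ^+ 2 <= 16 * n%:R ^+ 2.
  case/andP => hz hz'; apply: le_trans (sum_norm2_pair hz hz').
  apply: le_trans (block_sum_le _ _ _) _; first by move=> x y; exact: sqr_ge0.
  apply: ler_sum => x _; apply: ler_sum => y _; rewrite /F /lightF real_normK ?num_real//.
  by case: ifP => // _; rewrite expr0n sqr_ge0.
apply: (@chainE_exp_union _ light_net l light_fail g c).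
- move=> zz ok a b.
  have vv : 0 < v a * v b by rewrite mulr_gt0.
  rewrite (eq_bigr (fun x => \sum_(y | sigma y == b) expR (- (2 * th * mF zz a b + 2 * ka)) * expR (2 * th * F zz x y))); last first.
    move=> x /eqP xa; apply: eq_bigr => y /eqP yb; rewrite -expRD /g xa yb; congr expR; ring.
  under eq_bigr do rewrite -mulr_sumr; rewrite -mulr_sumr.
  rewrite expRN mulrC ler_pdivrMr ?expR_gt0//.
  apply: (@le_trans _ _ (v a * v b * (1 + (2 * th * mF zz a b + 2 * ka)))); last first.
    by rewrite ler_pM2l// expR_ge1Dx.
  apply: (@le_trans _ _ (\sum_(x | sigma x == a) \sum_(y | sigma y == b)
      (1 + 2 * th * F zz x y + 8 * th ^+ 2 * F zz x y ^+ 2))).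
    apply: ler_sum => x _; apply: ler_sum => y _.
    have -> : 8 * th ^+ 2 * F zz x y ^+ 2 = 2 * (2 * th * F zz x y) ^+ 2 by ring.
    apply: expR_le_quadratic.
    have -> : 2^-1 = 2 * th * t by rewrite /th; field; rewrite gt_eqF.
    by rewrite ler_wpM2l ?mulr_ge0//; exact: le_trans (ler_norm _) (F_le _ _ _).
  under eq_bigr do rewrite !big_split /=.
  rewrite !big_split /= block_sum_const.
  under [X in _ + X + _ <= _]eq_bigr do rewrite -mulr_sumr.
  under [X in _ + X <= _]eq_bigr do rewrite -mulr_sumr.
  rewrite -!mulr_sumr mulr1 mulrDr mulr1 -addrA lerD2l mulrDr.
  apply: lerD; first by rewrite /mF le_eqVlt; apply/orP; left; apply/eqP; field; rewrite !gt_eqF.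
  have h := le_block_avg a b (sumr_ge0 _ (fun x _ => sumr_ge0 _ (fun y _ => sqr_ge0 (F zz x y)))) (F_sqr zz a b ok).
  apply: le_trans (ler_wpM2l _ h) _; first by rewrite mulr_ge0 ?sqr_ge0.
  by rewrite le_eqVlt; apply/orP; left; apply/eqP; rewrite /ka; field; rewrite gt_eqF.
- move=> zz x s ok sl; rewrite /light_fail -ltNge.
  under eq_bigr do under eq_bigr do rewrite mulrBr.
  under eq_bigr do rewrite big_split /= sumrN.
  rewrite big_split /= sumrN sum_path_counts sum_cluster_mean => h.
  have -> : psum (g zz) x s = th * (psum (F zz) x s - psum (fun u w => mF zz (sigma u) (sigma w)) x s) - ka * l%:R.
    by rewrite -sl /g; elim: s x {sl h} => [|y s IHs] x /=; [ring | rewrite IHs -natr1; ring].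
  have e : c zz <= 12 * n%:R + r by case/andP: ok; rewrite /c; lra.
  apply: (le_trans e).
  have kl : ka * l%:R <= 16 * B ^+ 2 * n%:R.
    apply: (@le_trans _ _ (ka * (4 * t ^+ 2 * n%:R))).
      by rewrite ler_wpM2l// /ka mulr_ge0 ?mulr_ge0 ?sqr_ge0.
    by rewrite /ka /th le_eqVlt; apply/orP; left; apply/eqP; field; rewrite gt_eqF.
  have h' : th * (light_const * (t * n%:R)) <= th * (psum (F zz) x s - psum (fun u w => mF zz (sigma u) (sigma w)) x s).
    by rewrite ler_wpM2l// ltW.
  have e2 : th * (light_const * (t * n%:R)) = 16 * B ^+ 2 * n%:R + 12 * n%:R + r * n%:R.
    by rewrite /th /light_const; field; rewrite gt_eqF.
  have : r <= r * n%:R by rewrite -[leLHS]mulr1 ler_wpM2l.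
  by rewrite e2 in h'; lra.
- apply: (@le_trans _ _ (\sum_(zz : net * net) expR (- r) * (expR (- (norm2 R zz.1 + 2 * n%:R)) * expR (- (norm2 R zz.2 + 2 * n%:R))))).
    rewrite big_mkcond; apply: ler_sum => zz _; rewrite -!expRD.
    case: ifP => _; last exact: expR_ge0.
    by rewrite ler_expR /c; lra.
  rewrite -mulr_sumr -[leRHS]mulr1 ler_wpM2l ?expR_ge0//.
  rewrite -(pair_bigA _ (fun z z' : net => expR (- (norm2 R z + 2 * n%:R)) * expR (- (norm2 R z' + 2 * n%:R)))) /=.
  under eq_bigr do rewrite -mulr_sumr; rewrite -mulr_suml.
  have h := sum_expR_net R J n.
  by rewrite -[leRHS]mulr1 ler_pM// sumr_ge0// => z _; exact: expR_ge0.
Qed.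

Definition disc_level (q : ('I_J * {set 'I_n}) * ('I_J * {set 'I_n})) : bool :=
  (m < q.1.1 + q.2.1)%N.

Definition disc_fail (q : ('I_J * {set 'I_n}) * ('I_J * {set 'I_n}))
    (x : 'I_n) (s : seq 'I_n) : bool :=
  ~~ `[< discrepancy l m B r (cnt x s) q.1.1 q.2.1 q.1.2 q.2.2 >].

(** Chernoff bounds for all pairs of sets at once. Each set pays its own cost, so the sum over pairs
    factorizes. *)
Lemma disc_event : E l (fun x s =>
  [exists q : ('I_J * {set 'I_n}) * ('I_J * {set 'I_n}), disc_level q && disc_fail q x s]%:R)
  <= expR (- r).
Proof.
set I := ((_ * _) * _)%type.
pose k (q : I) := (q.1.1 + q.2.1 - m)%N.
(* Since exp (k / 2) <= 2^k, twice this number bounds the excess over 1 of the block average of the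
   exponential. *)
pose ka (q : I) : R := 2^-1 * (2 ^+ k q * B ^+ 2 * (#|q.1.2|%:R * #|q.2.2|%:R) / n%:R ^+ 2).
pose ind (q : I) x y : R := ((x \in q.1.2) && (y \in q.2.2))%:R.
pose g (q : I) x y : R := (k q)%:R / 4 * ind q x y - ka q.
pose c (q : I) := level_cost n r q.1.1 #|q.1.2| + level_cost n r q.2.1 #|q.2.2|.
apply: (@chainE_exp_union _ disc_level l disc_fail g c).
- move=> q _ a b; set tk : R := 2 ^+ k q.
  have tk1 : 1 <= tk by rewrite exprn_ege1// ler1n.
  have vv : 0 < v a * v b by rewrite mulr_gt0.
  rewrite (eq_bigr (fun x => \sum_(y | sigma y == b) expR (- (2 * ka q)) * expR (2 * ((k q)%:R / 4) * ind q x y))); last first.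
    by move=> x _; apply: eq_bigr => y _; rewrite -expRD /g; congr expR; ring.
  under eq_bigr do rewrite -mulr_sumr; rewrite -mulr_sumr.
  rewrite expRN mulrC ler_pdivrMr ?expR_gt0//.
  apply: (@le_trans _ _ (v a * v b * (1 + 2 * ka q))); last first.
    by rewrite ler_pM2l// expR_ge1Dx.
  apply: (@le_trans _ _ (\sum_(x | sigma x == a) \sum_(y | sigma y == b) (1 + tk * ind q x y))).
    apply: ler_sum => x _; apply: ler_sum => y _; rewrite /ind.
    case: (_ && _); rewrite /= ?mulr1 ?mulr0 ?expR0 ?addr0//.
    by apply: le_trans (expR_half_nat_le _ _) _; rewrite -/tk lerDr.
  under eq_bigr do rewrite big_split /=.
  rewrite big_split /= block_sum_const mulr1 mulrDr mulr1 lerD2l.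
  under eq_bigr do rewrite -mulr_sumr; rewrite -mulr_sumr.
  have i0 x y : 0 <= ind q x y by [].
  have h : \sum_(x | sigma x == a) \sum_(y | sigma y == b) ind q x y <= #|q.1.2|%:R * #|q.2.2|%:R.
    apply: le_trans (block_sum_le _ _ i0) _.
    rewrite le_eqVlt; apply/orP; left; apply/eqP; rewrite -!sum1_card !natr_sum mulr_suml.
    rewrite [RHS]big_mkcond; apply: eq_bigr => x _ /=; rewrite /ind.
    case: (x \in q.1.2) => /=; last by rewrite big1.
    by rewrite mul1r [RHS]big_mkcond; apply: eq_bigr => y _; case: (y \in _).
  have h2 := le_block_avg a b (sumr_ge0 _ (fun x _ => sumr_ge0 _ (fun y _ => i0 x y))) h.
  apply: le_trans (ler_wpM2l _ h2) _; first by rewrite exprn_ge0.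
  by rewrite le_eqVlt; apply/orP; left; apply/eqP; rewrite /ka -/tk; field; rewrite gt_eqF.
- move=> q x s _ sl; rewrite /disc_fail; apply: contraNT; rewrite -ltNge => h.
  apply/asboolP; rewrite /discrepancy -/(c q) -/(k q).
  have -> : edges (cnt x s) q.1.2 q.2.2 = psum (ind q) x s.
    rewrite -sum_path_counts /edges big_mkcond; apply: eq_bigr => a _ /=; rewrite /ind.
    case: (a \in q.1.2) => /=; last by rewrite big1// => b _; rewrite mul0r.
    by rewrite big_mkcond; apply: eq_bigr => b _ /=; case: (b \in _); rewrite ?mul1r ?mul0r.
  have e : psum (g q) x s = (k q)%:R / 4 * psum (ind q) x s - ka q * l%:R.
    by rewrite -sl /g; elim: s x {sl h} => [|y s IHs] x /=; [ring | rewrite IHs -natr1; ring].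
  have -> : 2^-1 * (2 ^+ k q * B ^+ 2 * l%:R * (#|q.1.2|%:R * #|q.2.2|%:R) / n%:R ^+ 2) = ka q * l%:R.
    by rewrite /ka; ring.
  by rewrite e in h; lra.
- pose w (u : 'I_J * {set 'I_n}) := expR (- level_cost n r u.1 #|u.2|).
  have w0 u : 0 <= w u by exact: expR_ge0.
  apply: (@le_trans _ _ (\sum_(q : I) w q.1 * w q.2)).
    rewrite big_mkcond; apply: ler_sum => q _; case: ifP => _; last by rewrite mulr_ge0.
    by rewrite /w -expRD ler_expR /c opprD.
  rewrite -(pair_bigA _ (fun u u' => w u * w u')) /=.
  under eq_bigr do rewrite -mulr_sumr; rewrite -mulr_suml.
  have h : \sum_u w u <= expR (- r).
    by rewrite -(pair_bigA _ (fun (i : 'I_J) (S : {set 'I_n}) => w (i, S))) /=; exact: sum_level_cost_expR.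
  have r1 : expR (- r) <= 1 by rewrite -expR0 ler_expR; move: r0; lra.
  rewrite -[leRHS]mulr1; apply: ler_pM; rewrite ?sumr_ge0//; exact: le_trans h r1.
Qed.

(** Chernoff bound with parameter 1, doubled to [expR 2] by the parity splitting; a single state has
    weight at most B / n in its cluster. The union bound is used with one index. *)
Lemma visits_event (y : 'I_n) (D : R) :
  E l (fun x s => (D <= visits (path_counts R x s) y)%R%:R) <=
  expR (expR 2 * B / 2 * (l%:R / n%:R) - D).
Proof.
pose ka : R := expR 2 * B / (2 * n%:R).
pose g (_ : unit) (_ z : 'I_n) : R := (z == y)%:R - ka.
have := @chainE_exp_union unit xpredT l (fun _ x s => D <= visits (path_counts R x s) y) g
  (fun=> D - ka * l%:R) (expR (expR 2 * B / 2 * (l%:R / n%:R) - D)).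
move=> H; apply: le_trans (H _ _ _).
- apply: le_chainE => [x z|x|x s _]; [exact: bmc_transition_ge0|exact: bmc_stationary_ge0|].
  have [h|_] := boolP (D <= _); last by rewrite ler0n.
  by case: existsP => [//|[]]; exists tt.
- move=> [] _ a b; have vv : 0 < v a * v b by rewrite mulr_gt0.
  rewrite (eq_bigr (fun x => \sum_(z | sigma z == b) expR (- (2 * ka)) * expR (2 * (z == y)%:R))); last first.
    by move=> x _; apply: eq_bigr => z _; rewrite -expRD /g; congr expR; ring.
  under eq_bigr do rewrite -mulr_sumr; rewrite -mulr_sumr.
  rewrite expRN mulrC ler_pdivrMr ?expR_gt0//.
  apply: (@le_trans _ _ (v a * v b * (1 + 2 * ka))); last first.
    by rewrite ler_pM2l// expR_ge1Dx.
  apply: (@le_trans _ _ (\sum_(x | sigma x == a) \sum_(z | sigma z == b) (1 + expR 2 * (z == y)%:R))).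
    apply: ler_sum => x _; apply: ler_sum => z _.
    by case: (z == y); rewrite /= ?mulr1 ?mulr0 ?expR0 ?addr0// lerDr.
  under eq_bigr do rewrite big_split /=.
  rewrite big_split /= block_sum_const mulr1 mulrDr mulr1 lerD2l.
  under eq_bigr do rewrite -mulr_sumr; rewrite -mulr_sumr.
  apply: (@le_trans _ _ (expR 2 * v a)).
    rewrite ler_wpM2l ?expR_ge0// -(sum_cluster1 R sigma a); apply: ler_sum => x _.
    rewrite big_mkcond (bigD1 y)//= eqxx big1 ?addr0; first by case: ifP.
    by move=> z /negbTE ->; case: ifP.
  have -> : v a * v b * (2 * ka) = expR 2 * v a * (B * v b / n%:R).
    by rewrite /ka; field; rewrite gt_eqF.
  rewrite -[leLHS]mulr1 ler_wpM2l ?mulr_ge0 ?expR_ge0//.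
  by rewrite ler_pdivlMr// mul1r.
- move=> [] x s _ sl h.
  have e : psum (g tt) x s = visits (path_counts R x s) y - ka * l%:R.
    have -> : visits (path_counts R x s) y = psum (fun _ z => (z == y)%:R) x s.
      rewrite -sum_path_counts; apply: eq_bigr => a _.
      rewrite (bigD1 y)//= eqxx mul1r big1 ?addr0// => b /negbTE ->; exact: mul0r.
    by rewrite -sl /g; elim: s x {sl h} => [|z s IHs] x /=; [ring | rewrite IHs -natr1; ring].
  by rewrite e lerD2r.
- rewrite (big_pred1 tt) => [|[]//]; rewrite ler_expR /ka le_eqVlt; apply/orP; left; apply/eqP.
  by field; rewrite gt_eqF.
Qed.

End Events.

(** * The bound with high probability *)

Lemma sigma1_ge0 (R : realType) (n : nat) (A : 'M[R]_n) : 0 <= sigma1 A.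
Proof.
rewrite /sigma1; set S := [set _ | _ in _].
have [hS|/sup_out ->//] := pselect (has_sup S).
have [a [b hb hab]] := hS.1; have := sup_upper_bound hS.
by move=> /(_ a (ex_intro2 _ _ b hb hab)); apply: le_trans; rewrite -hab sqrtr_ge0.
Qed.

Lemma restrict_mxT (R : realType) (n : nat) (M : 'M[R]_n) : restrict_mx [set: 'I_n]%SET M = M.
Proof. by apply/matrixP => x y; rewrite mxE !inE mulr1. Qed.

Section PathBound.
Variables (R : realType) (K n : nat) (sigma : 'I_n -> 'I_K).
Variables (p : 'M[R]_K) (pi : 'rV[R]_K) (B : R).
Hypothesis hp : stochastic p.
Hypothesis hpi : stationary p pi.
Hypothesis n0 : (0 < n)%N.
Hypothesis B1 : 1 <= B.
Hypothesis hB : forall k, n%:R <= B * #|bmc_cluster sigma k|%:R.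
Variables (l m J : nat) (r H : R).
Hypothesis hl : (4 ^ m * n <= l < 4 ^ m.+1 * n)%N.
Hypothesis hJ : (4 * n < 4 ^ J <= 16 * n)%N.
Hypothesis r0 : 0 <= r.
Hypothesis H0 : 0 < H.

Local Notation v k := (#|bmc_cluster sigma k|%:R : R).
Local Notation P := (fun x y => bmc_transition sigma p x y).
Local Notation mu := (fun x => bmc_stationary sigma pi 0 x).
Local Notation E := (chainE P mu).
Local Notation t := (2 ^+ m : R).
Local Notation cnt x s := (fun a b => path_counts R x s a b).

Let nR : 0 < n%:R :> R. Proof. by rewrite ltr0n. Qed.
Let nR0 : 0 <= n%:R :> R. Proof. exact: ltW. Qed.
Let n1 : 1 <= n%:R :> R. Proof. by rewrite ler1n. Qed.
Let t_gt0 : 0 < t. Proof. by rewrite exprn_gt0. Qed.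
Let t_ge1 : 1 <= t. Proof. by rewrite exprn_ege1// ler1n. Qed.
Let v0 k : 0 < v k.
Proof.
have := lt_le_trans nR (hB k); rewrite pmulr_rgt0//; exact: lt_le_trans B1.
Qed.
Let hsurj k : (0 < #|bmc_cluster sigma k|)%N.
Proof. by have := v0 k; rewrite ltr0n. Qed.
Let l_le : l%:R <= 4 * t ^+ 2 * n%:R :> R.
Proof.
have [_ /ltnW] := andP hl; rewrite -(ler_nat R) natrM expnS natrM.
by rewrite sqr_exp2.
Qed.

Lemma bmc_stationaryP :
  bmc_stationary sigma pi *m bmc_transition sigma p = bmc_stationary sigma pi.
Proof.
have [pi0 pi1 pip] := hpi; apply/rowP => y; rewrite !mxE.
under eq_bigr => x _ do rewrite !mxE mulrA.
rewrite -mulr_suml (sum_cluster_weight sigma (pi 0) (fun x => p (sigma x) (sigma y))).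
congr (_ / _); rewrite -[in RHS]pip mxE; apply: eq_bigr => b _; congr (_ * _).
rewrite (eq_bigr (fun=> p b (sigma y) * 1)) => [|x /eqP -> //]; last by rewrite mulr1.
by rewrite -mulr_sumr sum_cluster1 mulfK// gt_eqF.
Qed.

Definition dev_fail (ab : 'I_K * 'I_K) (x : 'I_n) (s : seq 'I_n) : bool :=
  H * t * n%:R < `|cluster_count sigma (cnt x s) ab.1 ab.2 - l%:R * (pi 0 ab.1 * p ab.1 ab.2)|.

(** Chebyshev's inequality for each pair of clusters. The threshold H t n exceeds the standard
    deviation, of order t sqrt n, by a factor sqrt n; of this only n >= 1 is kept. *)
Lemma dev_event (C : R) : 0 < C ->
  (forall a b, E l (fun x s => (psum (fun x y => ((sigma x == a) && (sigma y == b))%:R) x s -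
       l%:R * (pi 0 a * p a b)) ^+ 2) <= C * l%:R) ->
  E l (fun x s => [exists ab : 'I_K * 'I_K, dev_fail ab x s]%:R) <= K%:R ^+ 2 * (4 * C / H ^+ 2).
Proof.
move=> C0 hC; have [pi0 pi1 pip] := hpi; set eta := H * t * n%:R.
have eta0 : 0 < eta by rewrite !mulr_gt0.
pose D (ab : 'I_K * 'I_K) x s := psum (fun x y => ((sigma x == ab.1) && (sigma y == ab.2))%:R) x s -
       l%:R * (pi 0 ab.1 * p ab.1 ab.2).
apply: (@le_trans _ _ (E l (fun x s => \sum_ab (eta ^+ 2)^-1 * D ab x s ^+ 2))).
  apply: le_chainE => [x y|x|x s st]; [exact: bmc_transition_ge0|exact: bmc_stationary_ge0|].
  have pos ab : 0 <= (eta ^+ 2)^-1 * D ab x s ^+ 2 by rewrite mulr_ge0 ?invr_ge0 ?sqr_ge0.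
  case: existsP => [[ab hab]|_]; last by rewrite sumr_ge0.
  rewrite (bigD1 ab)//= -[leLHS]addr0 lerD ?sumr_ge0//.
  rewrite mulrC ler_pdivlMr ?exprn_gt0// mul1r.
  move: hab; rewrite /dev_fail cluster_countE -/eta -/(D ab x s) => hab.
  by rewrite -[leRHS]real_normK ?num_real// ler_sqr ?nnegrE// ltW.
rewrite chainE_sum.
apply: (@le_trans _ _ (\sum_(ab : 'I_K * 'I_K) 4 * C / H ^+ 2)); last first.
  by rewrite sumr_const card_prod card_ord -[leLHS]mulr_natl natrM expr2.
apply: ler_sum => -[a b] _; rewrite chainEZ mulrC ler_pdivrMr ?exprn_gt0//.
apply: le_trans (hC a b) _; apply: (@le_trans _ _ (C * (4 * t ^+ 2 * n%:R))).
  by rewrite ler_wpM2l// ltW.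
have -> : 4 * C / H ^+ 2 * eta ^+ 2 = C * (4 * t ^+ 2 * n%:R) * n%:R by rewrite /eta; field; rewrite gt_eqF.
by rewrite -[leLHS]mulr1 ler_wpM2l// !mulr_ge0 ?exprn_ge0// ?ltW.
Qed.

Definition path_fail (x : 'I_n) (s : seq 'I_n) : bool :=
  [|| [exists ab : 'I_K * 'I_K, dev_fail ab x s],
      [exists zz : {ffun 'I_n -> code J} * {ffun 'I_n -> code J},
         light_net R zz && light_fail sigma B m r zz x s]
    | [exists q : ('I_J * {set 'I_n}) * ('I_J * {set 'I_n}),
         disc_level m q && disc_fail B l m r q x s]].

(* Every state is left as often as it is entered, up to one unit. *)
Lemma row_sum_le_visits (x : 'I_n) (s : seq 'I_n) (y : 'I_n) :
  \sum_z path_counts R x s y z <= visits (path_counts R x s) y + 1.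
Proof.
have -> : \sum_z path_counts R x s y z = psum (fun a _ => (a == y)%:R) x s.
  rewrite -sum_path_counts [RHS](bigD1 y)//= [X in _ + X]big1 ?addr0 => [|a /negbTE ay].
    by apply: eq_bigr => b _; rewrite eqxx mul1r.
  by rewrite big1// => b _; rewrite ay mul0r.
have -> : visits (path_counts R x s) y = psum (fun _ z => (z == y)%:R) x s.
  rewrite -sum_path_counts; apply: eq_bigr => a _.
  rewrite (bigD1 y)//= eqxx mul1r big1 ?addr0// => b /negbTE ->; exact: mul0r.
have := psum_telescope (fun a => (a == y)%:R : R) x s.
have -> : psum (fun a b => (b == y)%:R - (a == y)%:R : R) x s =
    psum (fun _ b => (b == y)%:R) x s - psum (fun a _ => (a == y)%:R) x s.
  by elim: s x => [|z s IHs] x /=; [ring | rewrite IHs; ring].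
have : 0 <= (last x s == y)%:R :> R by [].
have : (x == y)%:R <= 1 :> R by case: (x == y).
by lra.
Qed.

Definition path_const (Delta0 : R) : R :=
  4 * (light_const B r + 8 * (4 * Delta0 + 1) + 208 * B ^+ 2 + 48 * (33 + 16 * r) + 4 * B ^+ 2 * H).

Lemma path_bound (Delta0 : R) (x : 'I_n) (s : seq 'I_n) (Gamma : {set 'I_n}) (N : 'M[R]_n) :
  0 <= Delta0 -> size s = l -> ~~ path_fail x s ->
  (forall a b, N a b = l%:R * bmc_stationary sigma pi 0 a * bmc_transition sigma p a b) ->
  #|~: Gamma|%:R <= n%:R * expR (- (l%:R / n%:R)) :> R ->
  (forall y, y \in Gamma -> visits (path_counts R x s) y <= Delta0 * (l%:R / n%:R)) ->
  sigma1 (restrict_mx Gamma (path_counts R x s) - N) <= path_const Delta0 * t.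
Proof.
move=> D0 sl; rewrite /path_fail !negb_or => /and3P[/existsPn hdev /existsPn hlight /existsPn hdisc].
move=> hN hG hvis; have [pi0 pi1 pip] := hpi.
have B0 : 0 <= B by exact: le_trans B1.
have t0 := ltW t_gt0.
have d_le : l%:R / n%:R <= 4 * t ^+ 2 :> R by rewrite ler_pdivrMr.
have t2 : 1 <= t ^+ 2 by rewrite exprn_ege1.
(* The factor 4 comes from l / n <= 4 t^2; the added 1 is the possible excess of departures over
   arrivals. *)
have deg : Delta0 * (l%:R / n%:R) + 1 <= (4 * Delta0 + 1) * t ^+ 2.
  have : Delta0 * (l%:R / n%:R) <= Delta0 * (4 * t ^+ 2) by rewrite ler_wpM2l.
  by lra.
have L0 : 0 <= light_const B r.
  by rewrite /light_const; have := sqr_ge0 B; move: r0; lra.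
apply: (@sigma1_trimmed_le R K n sigma l m J B r (4 * Delta0 + 1) (light_const B r) H) => //.
- by lra.
- exact: ltW.
- by move=> a b; exact: path_counts_ge0.
- by rewrite path_counts_total sl.
- move=> y yG; apply: le_trans (row_sum_le_visits x s y) _.
  by apply: le_trans deg; rewrite lerD2r hvis.
- move=> y yG; apply: le_trans (hvis y yG) (le_trans _ deg).
  by rewrite lerDl.
- move=> i j S T mij; have := hdisc ((i, S), (j, T)).
  by rewrite /disc_level /= mij /= /disc_fail negbK => /asboolP.
- move=> z z' hz hz'; have := hlight (z, z').
  by rewrite /light_net /= hz hz' /= /light_fail negbK.
- move=> a b; rewrite hN !mxE.
  have pia1 : pi 0 (sigma a) <= 1 by rewrite -pi1 (bigD1 (sigma a))//= lerDl sumr_ge0.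
  have p0 : 0 <= p (sigma a) (sigma b) by exact: hp.1.
  have p1 : p (sigma a) (sigma b) <= 1.
    by rewrite -(hp.2 (sigma a)) (bigD1 (sigma b))//= lerDl sumr_ge0// => j _; exact: hp.1.
  have -> : l%:R * (pi 0 (sigma a) / v (sigma a)) * (p (sigma a) (sigma b) / v (sigma b)) =
     l%:R * ((pi 0 (sigma a) * p (sigma a) (sigma b)) * (v (sigma a) * v (sigma b))^-1).
    by field; rewrite !gt_eqF.
  have w0 : 0 <= pi 0 (sigma a) * p (sigma a) (sigma b) by rewrite mulr_ge0.
  have w1 : pi 0 (sigma a) * p (sigma a) (sigma b) <= 1 by rewrite -[leRHS]mul1r ler_pM.
  have i0 : 0 <= (v (sigma a) * v (sigma b))^-1 by rewrite invr_ge0 mulr_ge0.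
  rewrite !mulr_ge0//= ler_wpM2l// -[leRHS]mul1r ler_pM//.
  exact: inv_cluster_le.
- move=> a b; rewrite hN !mxE /cluster_mean.
  set c := cluster_count _ _ _ _.
  have -> : c / (v (sigma a) * v (sigma b)) -
     l%:R * (pi 0 (sigma a) / v (sigma a)) * (p (sigma a) (sigma b) / v (sigma b)) =
     (c - l%:R * (pi 0 (sigma a) * p (sigma a) (sigma b))) * (v (sigma a) * v (sigma b))^-1.
    by field; rewrite !gt_eqF.
  have i0 : 0 <= (v (sigma a) * v (sigma b))^-1 by rewrite invr_ge0 mulr_ge0.
  rewrite normrM (ger0_norm i0) ler_pM ?inv_cluster_le//.
  by have := hdev (sigma a, sigma b); rewrite /dev_fail -leNgt.
Qed.

Lemma path_fail_event (C : R) : 0 < C ->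
  (forall a b, E l (fun x s => (psum (fun x y => ((sigma x == a) && (sigma y == b))%:R) x s -
       l%:R * (pi 0 a * p a b)) ^+ 2) <= C * l%:R) ->
  E l (fun x s => (path_fail x s)%:R) <= K%:R ^+ 2 * (4 * C / H ^+ 2) + (expR (- r) + expR (- r)).
Proof.
move=> C0 hC; have [pi0 pi1 pip] := hpi.
apply: le_trans (lerD (dev_event C0 hC) (lerD
  (light_event hp pi0 pi1 n0 B1 hB J hl r0)
  (disc_event hp pi0 pi1 n0 B1 hB l m J r0))).
rewrite -!chainED; apply: le_chainE => [x y|x|x s st]; [exact: bmc_transition_ge0|exact: bmc_stationary_ge0|].
rewrite /path_fail; set b1 := [exists _, _]; set b2 := [exists _, _]; set b3 := [exists _, _].
by case: b1; case: b2; case: b3; rewrite /= ?mulr1n ?mulr0n; lra.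
Qed.

End PathBound.

(** The lower limit is the opposite of an infimum of suprema of the negated sequence; if it is
    positive, one of these suprema is negative, and its opposite serves as [c]. A supremum equal to
    -oo is contradictory on its index set. *)
Lemma is_Omega_near (R : realType) (a b : nat -> R) : is_Omega a b ->
  exists2 c : R, 0 < c & \forall n \near \oo, c <= a n / b n.
Proof.
rewrite /is_Omega /limn_einf oppe_gt0 => /ereal_inf_lt[_ [V hV <-]] hs.
pose s := ereal_sup [set (\- (fun n => (a n / b n)%:E))%E x | x in V].
have us n : V n -> (- (a n / b n)%:E <= s)%E.
  by move=> Vn; apply: ereal_sup_ubound; exists n.
rewrite -/s in hs; move: s us hs => [c| |] us hs //.
  rewrite lte_fin in hs; exists (- c); first by rewrite oppr_gt0.
  by apply: filterS hV => n Vn; have := us n Vn; rewrite -EFinN lee_fin lerNl.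
by exists 1 => //; apply: filterS hV => n Vn; have := us n Vn; rewrite leeNy_eq.
Qed.

Lemma dyadic_scales (n l : nat) : (0 < n)%N -> (n <= l)%N ->
  exists m J, (4 ^ m * n <= l < 4 ^ m.+1 * n)%N /\ (4 * n < 4 ^ J <= 16 * n)%N.
Proof.
move=> n0 nl; exists (trunc_log 4 (l %/ n)), (trunc_log 4 (4 * n)).+1.
have ln0 : (0 < l %/ n)%N by rewrite divn_gt0.
have /andP[h1 h2] := trunc_log_bounds (isT : (1 < 4)%N) ln0.
have n4 : (0 < 4 * n)%N by rewrite muln_gt0.
have /andP[h3 h4] := trunc_log_bounds (isT : (1 < 4)%N) n4.
by rewrite -leq_divRL// h1 -ltn_divLR// h2 h4 expnS; split=> //; lia.
Qed.

Section Probability.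
Variables (R : realType) (K : nat) (p : 'M[R]_K) (pi : 'rV[R]_K).
Hypothesis hp : stochastic p.
Hypothesis hirr : irreducible p.
Hypothesis hpi : stationary p pi.

(** Common form of both cases: [regular] describes the paths on which few states are removed and the
    visits to the remaining ones are bounded. Four failures of probability at most eps / 4 are
    allowed, and [delta] is chosen before [n], [sigma] and [l]. *)
Lemma block_markov_bound (B Delta0 eps : R) : 1 <= B -> 0 <= Delta0 -> 0 < eps ->
  exists delta : R, forall (n : nat) (sigma : 'I_n -> 'I_K) (l : nat)
    (d : measure_display) (T : measurableType d) (Pr : probability T R)
    (X : nat -> T -> 'I_n) (Gamma : T -> {set 'I_n})
    (regular : 'I_n -> seq 'I_n -> bool),
  (0 < n)%N -> (n <= l)%N ->
  (forall k, n%:R <= B * #|bmc_cluster sigma k|%:R) ->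
  markov_chain Pr (bmc_stationary sigma pi) (bmc_transition sigma p) X ->
  (forall G, measurable [set w | Gamma w = G]) ->
  chainE (fun x y => bmc_transition sigma p x y) (fun x => bmc_stationary sigma pi 0 x) l
    (fun x s => (~~ regular x s)%:R) <= eps / 4 ->
  (forall w, regular (X 0%N w) [seq X i w | i <- iota 1 l] ->
     #|~: Gamma w|%:R <= n%:R * expR (- (l%:R / n%:R)) :> R /\
     forall y, y \in Gamma w ->
       visits (count_mx R l (fun t => X t w)) y <= Delta0 * (l%:R / n%:R)) ->
  (Pr [set w | (delta <= `|sigma1 (restrict_mx (Gamma w) (count_mx R l (fun t => X t w)) -
     expectation_mx Pr (fun w => count_mx R l (fun t => X t w))) /
     Num.sqrt (l%:R / n%:R)|)%R] <= eps%:E)%E.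
Proof.
move=> B1 D0 eps0; have [C C0 hC] := cluster_count_variance hp hirr hpi.
have [pi0 pi1 pip] := hpi.
(* From exp r >= 1 + r, this makes exp (- r) at most eps / 4. *)
pose r : R := 4 / eps; have r0 : 0 < r by rewrite divr_gt0.
(* Makes 4 C K^2 at most H eps / 4, hence the Chebyshev bound at most eps / 4, as H >= 1. *)
pose H : R := 1 + 16 * K%:R ^+ 2 * C / eps.
have H1 : 1 <= H by rewrite lerDl divr_ge0 ?mulr_ge0 ?sqr_ge0// ltW.
have H0 : 0 < H by exact: lt_le_trans H1.
have cr : expR (- r) <= eps / 4.
  have := expR_ge1Dx r; rewrite expRN => h.
  have -> : eps / 4 = r^-1 by rewrite invf_div.
  by rewrite lef_pV2 ?posrE ?expR_gt0//; lra.
have cH : K%:R ^+ 2 * (4 * C / H ^+ 2) <= eps / 4.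
  rewrite mulrA ler_pdivrMr ?exprn_gt0//.
  have HH : H <= H ^+ 2 by rewrite expr2 -[leLHS]mulr1 ler_wpM2l// ltW.
  apply: (@le_trans _ _ (eps / 4 * H)); last by rewrite ler_wpM2l// divr_ge0// ltW.
  have -> : eps / 4 * H = eps / 4 + K%:R ^+ 2 * (4 * C) by rewrite /H; field; rewrite gt_eqF.
  by rewrite lerDr divr_ge0// ltW.
(* The added 1 makes the bound strict, since the event contains the case of equality with
   [delta]. *)
exists (path_const B r H Delta0 + 1) => n sigma l d T Pr X Gamma reg n0 nl hB hX mG hreg hGamma.
have [m [J [hl hJ]]] := dyadic_scales n0 nl.
have nR : 0 < n%:R :> R by rewrite ltr0n.
have l0 : (0 < l)%N by exact: leq_trans nl.
have hsurj k : (0 < #|bmc_cluster sigma k|)%N.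
  have := lt_le_trans nR (hB k); rewrite pmulr_rgt0 ?ltr0n//; exact: lt_le_trans B1.
set N := expectation_mx _ _.
have hN a b : N a b = l%:R * bmc_stationary sigma pi 0 a * bmc_transition sigma p a b.
  apply: expectation_count_mx => //; exact: (bmc_stationaryP hpi n0 B1 hB).
pose fail x s := path_fail sigma p pi B l m J r H x s || ~~ reg x s.
have traj w : count_mx R l (fun t => X t w) =
    path_counts R (X 0%N w) [seq X i w | i <- iota 1 l].
  by rewrite (path_counts_traj R (fun t => X t w)).
have fail_le : (Pr [set w | fail (X 0%N w) [seq X i w | i <- iota 1 l]] <= eps%:E)%E.
  rewrite (markov_chainE hX) lee_fin.
  have := path_fail_event hp hpi n0 B1 hB J hl (ltW r0) H0 C0 (fun a b => hC n sigma l a b hsurj l0).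
  move=> hpf; apply: (@le_trans _ _ (K%:R ^+ 2 * (4 * C / H ^+ 2) + (expR (- r) + expR (- r)) + eps / 4)); last by lra.
  apply: le_trans (lerD hpf hreg); rewrite -chainED.
  apply: le_chainE => [x y|x|x s st]; [exact: bmc_transition_ge0|exact: bmc_stationary_ge0|].
  by rewrite /fail; case: (path_fail _ _ _ _ _ _ _ _ _ _ _); case: (reg x s); rewrite /= ?mulr1n ?mulr0n; lra.
apply: le_trans fail_le; apply: le_measure.
- rewrite inE; pose A := [set q : {set 'I_n} * seq 'I_n | if q.2 is x :: s then
    (path_const B r H Delta0 + 1 <= `|sigma1 (restrict_mx q.1 (path_counts R x s) - N) /
       Num.sqrt (l%:R / n%:R)|) : Prop else False].
  rewrite (_ : [set w | _] = [set w | A (Gamma w, [seq X i w | i <- iota 0 l.+1])]).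
    by apply: (markov_traj_measurable hX); exact: discrete_measurable_fibers.
  by apply/seteqP; split=> w /=; rewrite traj.
- rewrite inE; pose A := [set q : {set 'I_n} * seq 'I_n | if q.2 is x :: s then
    fail x s : Prop else False].
  rewrite (_ : [set w | _] = [set w | A (Gamma w, [seq X i w | i <- iota 0 l.+1])]).
    by apply: (markov_traj_measurable hX); exact: discrete_measurable_fibers.
  by apply/seteqP; split.
- move=> w /= hw; apply: contraLR hw => /norP[hpf]; rewrite negbK => hr.
  have [hG hv] := hGamma w hr.
  have rate0 : 0 < Num.sqrt (l%:R / n%:R : R) by rewrite sqrtr_gt0 divr_gt0// ltr0n.
  have t_le : 2 ^+ m <= Num.sqrt (l%:R / n%:R : R).
    rewrite -[leLHS]ger0_norm ?exprn_ge0// -sqrtr_sqr ler_wsqrtr// ler_pdivlMr//.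
    by rewrite sqr_exp2 -natrM ler_nat; case/andP: hl.
  rewrite -ltNge ger0_norm ?divr_ge0 ?sigma1_ge0 ?sqrtr_ge0// ltr_pdivrMr//.
  have sz : size [seq X i w | i <- iota 1 l] = l by rewrite size_map size_iota.
  rewrite traj in hv *.
  have main := path_bound hp hpi n0 B1 hB hl hJ (ltW r0) H0 D0 sz hpf hN hG hv.
  have c0 : 0 <= path_const B r H Delta0.
    have e1 : 0 <= B ^+ 2 * H by rewrite mulr_ge0 ?sqr_ge0// ltW.
    by have := sqr_ge0 B; rewrite /path_const /light_const; move: (ltW r0); lra.
  apply: (le_lt_trans main); apply: (@le_lt_trans _ _ (path_const B r H Delta0 * Num.sqrt (l%:R / n%:R))).
    by rewrite ler_wpM2l.
  by rewrite ltr_pM2r// ltrDl.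
Qed.

End Probability.

(** * Often visited states and trimming *)

Section RegularVisits.
Variables (R : realType) (n : nat).

Definition often_visited (M : 'M[R]_n) (D : R) : {set 'I_n} :=
  [set y | D <= visits M y]%SET.

(** If a kept state had more than [D] visits, then so many would each removed state have; together
    they would be more than a states visited at least [D] times, as the number of removed states is
    the integer part of a. *)
Lemma trims_regular (l : nat) (M : 'M[R]_n) (G : {set 'I_n}) (D : R) :
  trims_most_visited l M G ->
  #|often_visited M D|%:R <= n%:R * expR (- (l%:R / n%:R)) :> R ->
  #|~: G|%:R <= n%:R * expR (- (l%:R / n%:R)) :> R /\
  forall y, y \in G -> visits M y <= D.
Proof.
set a := _ * _; move=> [hcard hG] hfew.
have card_le : #|~: G|%:R <= a.
  by have := floor_le a; rewrite -hcard.
split=> // y yG; rewrite leNgt; apply/negP => Dy.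
have sub : y |: ~: G \subset often_visited M D.
  apply/fintype.subsetP => x; rewrite !inE => /predU1P[->|xG]; first exact: ltW.
  exact: le_trans (ltW Dy) (hG x y xG yG).
have := subset_leq_card sub; rewrite cardsU1 !inE yG /= add1n.
rewrite -(ler_nat R) => h; have := le_trans h hfew.
have := floorD1_gt a; rewrite -hcard -[_ + 1]/(#|~: G| + 1)%:Z addn1 => lt1 le1.
by have := lt_le_trans lt1 le1; rewrite ltxx.
Qed.

Variables (K : nat) (sigma : 'I_n -> 'I_K) (p : 'M[R]_K) (pi : 'rV[R]_K) (B : R).
Hypothesis hp : stochastic p.
Hypothesis pi0 : forall k, 0 <= pi 0 k.
Hypothesis pi1 : \sum_k pi 0 k = 1.
Hypothesis n0 : (0 < n)%N.
Hypothesis B1 : 1 <= B.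
Hypothesis hB : forall k, n%:R <= B * #|bmc_cluster sigma k|%:R.
Variable l : nat.
Local Notation E := (chainE (fun x y => bmc_transition sigma p x y)
  (fun x => bmc_stationary sigma pi 0 x)).

(** Markov's inequality for the number of often visited states, whose mean is at most n times the
    tail bound for one state. *)
Lemma many_often_visited_event (D a : R) : 0 < a ->
  E l (fun x s => (a <= #|often_visited (path_counts R x s) D|%:R)%R%:R) <=
  n%:R / a * expR (expR 2 * B / 2 * (l%:R / n%:R) - D).
Proof.
move=> a0; apply: (@le_trans _ _ (E l (fun x s =>
    \sum_y a^-1 * (D <= visits (path_counts R x s) y)%R%:R))).
  apply: le_chainE => [x y|x|x s _]; [exact: bmc_transition_ge0|exact: bmc_stationary_ge0|].
  rewrite -mulr_sumr mulrC; have -> : \sum_y (D <= visits (path_counts R x s) y)%R%:R =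
      #|often_visited (path_counts R x s) D|%:R :> R.
    rewrite -sum1_card natr_sum [RHS]big_mkcond; apply: eq_bigr => y _.
    by rewrite inE; case: (D <= _).
  have [h|_] := boolP (a <= _); first by rewrite ler_pdivlMr// mul1r.
  by rewrite divr_ge0// ltW.
rewrite chainE_sum.
apply: (@le_trans _ _ (\sum_(y < n) a^-1 * expR (expR 2 * B / 2 * (l%:R / n%:R) - D))).
  apply: ler_sum => y _; rewrite chainEZ; apply: ler_wpM2l; first by rewrite invr_ge0 ltW.
  exact: (visits_event hp pi0 pi1 n0 B1 hB l y D).
by rewrite sumr_const card_ord -[leLHS]mulr_natl mulrA.
Qed.

End RegularVisits.

(** * The two regimes of path length *)

Theorem theoremA1 (R : realType) (K : nat) (hK : (1 <= K)%N)
  (p : 'M[R]_K) (hp : stochastic p) (hirr : irreducible p)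
  (pi : 'rV[R]_K) (hpi : stationary p pi)
  (alpha : 'I_K -> R) (halpha1 : \sum_k alpha k = 1)
  (halpha0 : forall k, 0 < alpha k)
  (sigma : forall n : nat, 'I_n.+1 -> 'I_K)
  (hsurj : \forall n \near \oo, forall k, exists x, sigma n x = k)
  (hcluster : forall k,
     #|bmc_cluster (sigma n) k|%:R / n.+1%:R @[n --> \oo] --> alpha k)
  (l : nat -> nat) (hl : forall n, (0 < l n)%N)
  (d : nat -> measure_display) (T : forall n, measurableType (d n))
  (Pr : forall n, probability (T n) R)
  (X : forall n : nat, nat -> T n -> 'I_n.+1)
  (hX : \forall n \near \oo,
     markov_chain (Pr n) (bmc_stationary (sigma n) pi)
       (bmc_transition (sigma n) p) (X n)) :
  let Nhat (n : nat) (w : T n) : 'M[R]_n.+1 :=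
    count_mx R (l n) (fun t => X n t w) in
  let N (n : nat) : 'M[R]_n.+1 := expectation_mx (Pr n) (Nhat n) in
  let rate (n : nat) : R := Num.sqrt ((l n)%:R / n.+1%:R) in
  [/\ \forall n \near \oo, forall x y,
        N n x y = (l n)%:R * bmc_stationary (sigma n) pi 0 x
                  * bmc_transition (sigma n) p x y,
      is_Omega (fun n => (l n)%:R) (fun n => n.+1%:R * ln (n.+1%:R) : R) ->
        bigO_prob Pr (fun n w => sigma1 (Nhat n w - N n)) rate
    & is_omega (fun n => (l n)%:R) (fun n => n.+1%:R : R) ->
        forall Gamma : forall n : nat, T n -> {set 'I_n.+1},
        (\forall n \near \oo,
           (forall G, measurable [set w | Gamma n w = G]) /\
           (forall w, trims_most_visited (l n) (Nhat n w) (Gamma n w))) ->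
        bigO_prob Pr
          (fun n w => sigma1 (restrict_mx (Gamma n w) (Nhat n w) - N n)) rate].
Proof.
move=> Nhat N rate; have [pi0 pi1 pip] := hpi.
(* Eventually every cluster has more than a fraction alpha k / 2 of the states; the sum handles all
   clusters with one constant. *)
pose B : R := 1 + \sum_k 2 / alpha k.
have a2 k : 0 <= 2 / alpha k by rewrite divr_ge0// ltW.
have B1 : 1 <= B by rewrite lerDl sumr_ge0.
have B0 : 0 <= B by exact: le_trans B1.
have near_B : \forall n \near \oo, forall k,
    n.+1%:R <= B * #|bmc_cluster (sigma n) k|%:R.
  apply: filter_forall => k.
  have ak : alpha k / 2 < alpha k by have := halpha0 k; lra.
  apply: filterS (cvgr_gt _ (hcluster k) _ ak) => n; rewrite ltr_pdivlMr ?ltr0n// => h.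
  have ak0 := halpha0 k.
  apply: (@le_trans _ _ (2 / alpha k * #|bmc_cluster (sigma n) k|%:R)).
    have -> : n.+1%:R = 2 / alpha k * (alpha k / 2 * n.+1%:R) by field; rewrite gt_eqF.
    by rewrite ler_wpM2l// ltW.
  rewrite ler_wpM2r// /B (bigD1 k)//= addrCA lerDl addr_ge0// sumr_ge0//.
pose c2 : R := expR 2 * B / 2.
have c20 : 0 <= c2 by rewrite divr_ge0 ?mulr_ge0 ?expR_ge0.
split.
- near=> n => x y.
  have hBn : forall k, n.+1%:R <= B * #|bmc_cluster (sigma n) k|%:R by near: n.
  apply: expectation_count_mx; last by near: n.
  exact: (bmc_stationaryP hpi _ B1 hBn).
- move=> /is_Omega_near[c c0 hc] eps eps0.
  (* Nothing is trimmed here. At level (c2 + 2 / c) l / n the tail for one state is at most exp (-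
     (2 / c) l / n), hence at most the inverse square of the number of states, and the union bound
     over the states tends to 0. *)
  have D0 : 0 <= c2 + 2 / c by rewrite addr_ge0// divr_ge0// ltW.
  have [delta hdelta] := block_markov_bound hp hirr hpi B1 D0 eps0.
  have near_n (A : R) : \forall n \near \oo, A <= n%:R.
    by apply: cvgry_ge; exact: cvgr_idn.
  have [N0 _ hN0] : \forall n \near \oo, (Pr n [set w | (delta <= `|sigma1 (Nhat n w - N n) / rate n|)%R] <= eps%:E)%E.
    near=> n.
    have hBn : forall k, n.+1%:R <= B * #|bmc_cluster (sigma n) k|%:R by near: n.
    have hXn : markov_chain (Pr n) (bmc_stationary (sigma n) pi) (bmc_transition (sigma n) p) (X n) by near: n.
    have hcn : c <= (l n)%:R / (n.+1%:R * ln n.+1%:R) by near: n.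
    (* Ensures that [c] times the logarithm is at least 1, so that the path is at least as long as
       the number of states. *)
    have n_exp : expR (1 + c^-1) <= n%:R by near: n; exact: near_n.
    have n_eps : 4 / eps <= n%:R by near: n; exact: near_n.
    have n1 : 0 < n.+1%:R :> R by rewrite ltr0n.
    have n_le : n%:R <= n.+1%:R :> R by rewrite ler_nat.
    have ln_c : c^-1 <= ln (n.+1%:R : R).
      rewrite -ler_expR lnK ?posrE//; apply: le_trans n_le; apply: le_trans n_exp.
      by rewrite ler_expR; lra.
    have ln0 : 0 < ln (n.+1%:R : R) by apply: lt_le_trans ln_c; rewrite invr_gt0.
    have hd : c * ln n.+1%:R <= (l n)%:R / n.+1%:R.
      move: hcn; rewrite ler_pdivlMr ?mulr_gt0// => h.
      by rewrite ler_pdivlMr// -mulrA [ln _ * _]mulrC.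
    have d1 : 1 <= (l n)%:R / n.+1%:R :> R.
      apply: le_trans hd; rewrite -[leLHS](divff (lt0r_neq0 c0)).
      by apply: ler_wpM2l => //; exact: ltW.
    have nl : (n.+1 <= l n)%N by rewrite -(ler_nat R); rewrite ler_pdivlMr// mul1r in d1.
    pose D : R := (c2 + 2 / c) * ((l n)%:R / n.+1%:R).
    have -> : [set w | delta <= `|sigma1 (Nhat n w - N n) / rate n|] =
        [set w | delta <= `|sigma1 (restrict_mx [set: 'I_n.+1]%SET (Nhat n w) - N n) / rate n|].
      by apply/funext => w /=; rewrite restrict_mxT.
    apply: (hdelta n.+1 (sigma n) (l n) (d n) (T n) (Pr n) (X n) (fun=> [set: 'I_n.+1]%SET)
      (fun x s => ~~ (1 <= #|often_visited (path_counts R x s) D|%:R :> R))) => //.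
    + move=> G; have [->|GT] := eqVneq G [set: 'I_n.+1]%SET.
        by rewrite (_ : [set _ | _] = setT)//; apply/seteqP; split.
      rewrite (_ : [set _ | _] = set0)//; apply/seteqP; split=> // w /= h.
      by rewrite h eqxx in GT.
    + rewrite [X in chainE _ _ _ X](_ : _ = fun x s =>
        (1 <= #|often_visited (path_counts R x s) D|%:R :> R)%R%:R); last first.
        by apply/funext => x; apply/funext => s; rewrite negbK.
      apply: le_trans (many_often_visited_event hp pi0 pi1 _ B1 hBn _ _ _) _ => //.
      rewrite divr1 -/c2; apply: (@le_trans _ _ (n.+1%:R * expR (- (2 * ln n.+1%:R)))).
        apply: ler_wpM2l => //; rewrite ler_expR /D; set dn := (l n)%:R / n.+1%:R.
        have -> : c2 * dn - (c2 + 2 / c) * dn = - (2 / c * dn) by ring.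
        rewrite lerN2.
        have : 2 / c * (c * ln n.+1%:R) <= 2 / c * ((l n)%:R / n.+1%:R).
          by rewrite ler_wpM2l// divr_ge0// ltW.
        have -> : 2 / c * (c * ln n.+1%:R) = 2 * ln n.+1%:R by field; rewrite gt_eqF.
        by [].
      rewrite expRN expRM_natl lnK ?posrE//.
      have -> : n.+1%:R / n.+1%:R ^+ 2 = n.+1%:R^-1 :> R by field; rewrite gt_eqF.
      have -> : eps / 4 = (4 / eps)^-1 by rewrite invf_div.
      rewrite lef_pV2 ?posrE ?divr_gt0//; exact: le_trans n_le.
    + move=> w; rewrite (path_counts_traj R (fun t => X n t w)) => few; split.
        by rewrite finset.setCT cards0 mulr_ge0 ?expR_ge0.
      move=> y _; rewrite leNgt; apply/negP => Dy; case/negP: few.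
      rewrite ler1n card_gt0; apply/set0Pn; exists y; rewrite inE.
      by rewrite ltW.
  by exists delta, N0 => n /ltnW; exact: hN0.
- move=> hw Gamma hGamma eps eps0.
  (* At level (c2 + 2) l / n the expected number of often visited states is at most n exp (- 2 l /
     n); relative to the n exp (- l / n) states that may be removed, this leaves exp (- l / n),
     which tends to 0. *)
  have D0 : 0 <= c2 + 2 by rewrite addr_ge0.
  have [delta hdelta] := block_markov_bound hp hirr hpi B1 D0 eps0.
  have [N0 _ hN0] : \forall n \near \oo, (Pr n [set w | (delta <= `|sigma1 (restrict_mx (Gamma n w) (Nhat n w) - N n) / rate n|)%R] <= eps%:E)%E.
    near=> n.
    have hBn : forall k, n.+1%:R <= B * #|bmc_cluster (sigma n) k|%:R by near: n.
    have hXn : markov_chain (Pr n) (bmc_stationary (sigma n) pi) (bmc_transition (sigma n) p) (X n) by near: n.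
    have [mG trim] : (forall G, measurable [set w | Gamma n w = G]) /\
      (forall w, trims_most_visited (l n) (Nhat n w) (Gamma n w)) by near: n.
    have d_eps : 1 + 4 / eps <= (l n)%:R / n.+1%:R by near: n; exact: cvgry_ge hw _.
    have n1 : 0 < n.+1%:R :> R by rewrite ltr0n.
    have e0 : 0 < 4 / eps by rewrite divr_gt0.
    have nl : (n.+1 <= l n)%N.
      have : 1 <= (l n)%:R / n.+1%:R :> R by apply: le_trans d_eps; rewrite lerDl ltW.
      by rewrite ler_pdivlMr// mul1r ler_nat.
    pose dn : R := (l n)%:R / n.+1%:R.
    pose D : R := (c2 + 2) * dn.
    pose a : R := n.+1%:R * expR (- dn).
    have a0 : 0 < a by rewrite mulr_gt0 ?expR_gt0.
    apply: (hdelta n.+1 (sigma n) (l n) (d n) (T n) (Pr n) (X n) (Gamma n)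
      (fun x s => ~~ (a <= #|often_visited (path_counts R x s) D|%:R :> R))) => //.
    + rewrite [X in chainE _ _ _ X](_ : _ = fun x s =>
        (a <= #|often_visited (path_counts R x s) D|%:R :> R)%R%:R); last first.
        by apply/funext => x; apply/funext => s; rewrite negbK.
      apply: le_trans (many_often_visited_event hp pi0 pi1 _ B1 hBn _ _ a0) _ => //.
      rewrite -/c2 -/dn.
      have -> : n.+1%:R / a * expR (c2 * dn - D) = expR (- dn).
        rewrite /a invfM mulrA divff ?gt_eqF// mul1r -expRN opprK -expRD; congr expR.
        by rewrite /D; ring.
      have := expR_ge1Dx dn; rewrite expRN => h.
      have -> : eps / 4 = (4 / eps)^-1 by rewrite invf_div.
      rewrite lef_pV2 ?posrE ?expR_gt0//; apply: le_trans h; apply: (@le_trans _ _ (1 + 4 / eps)); first by rewrite lerDr.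
      apply: le_trans d_eps _.
      by rewrite -/dn lerDr.
    + move=> w; rewrite (path_counts_traj R (fun t => X n t w)) -ltNge => /ltW few.
      exact: trims_regular (trim w) few.
  by exists delta, N0 => n /ltnW; exact: hN0.
Unshelve. all: by end_near.
Qed.
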